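(* There exists a function $g\colon \mathbb{N}\times\mathbb{N}\to\mathbb{N}$ such that the following holds. Suppose $D$ is a digraph and $x,y$ are two distinct vertices of $D$ such that $\mu(x,y)>g(t,k)$ and $\mu(y,x)>g(t,k)$, for some $t,k\in\mathbb{N}$. Then at least one of the following holds: (1) $D$ contains the $t$-onion star as an immersion; (2) in $D$ there is a family of $2k$ pairwise arc-disjoint paths consisting of $k$ paths from $x$ to $y$ and $k$ paths from $y$ to $x$.
   Context: $\mathbb{N}$ is the set of positive integers. Digraphs may have parallel arcs but no loops. Each arc $a$ has a tail $\mathrm{tail}(a)$ and a head $\mathrm{head}(a)$; an arc $xy$ has tail $x$ and head $y$. A path in a digraph $D$ is a sequence $(a_1,\ldots,a_k)$ of pairwise distinct arcs with $\mathrm{head}(a_i)=\mathrm{tail}(a_{i+1})$ for all $1\le i<k$ (vertices may repeat). It is a path from $s$ to $s'$ if $\mathrm{tail}(a_1)=s$ and $\mathrm{head}(a_k)=s'$. Paths are arc-disjoint if they share no arc. For vertices $x,y$ of $D$, $\mu(x,y)$ is the maximum number of pairwise arc-disjoint paths from $x$ to $y$ in $D$. A digraph $D$ contains a digraph $H$ as an immersion if there is a mapping $\pi$ that sends vertices of $H$ to pairwise different vertices of $D$ and each arc $xy$ of $H$ to a path in $D$ from $\pi(x)$ to $\pi(y)$, such that the paths $\pi(a)$, $a\in A(H)$, are pairwise arc-disjoint. For $t\in\mathbb{N}$, the $t$-onion star is the digraph with vertex set $\{x,y_1,\ldots,y_t,z_1,\ldots,z_t\}$ ($2t+1$ distinct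 vertices) whose arcs are, for each $i\in\{1,\ldots,t\}$: one arc $y_ix$, one arc $xz_i$, two parallel arcs $xy_i$, and two parallel arcs $z_ix$. *)

(* Defs.v *)
From mathcomp Require Import all_boot.
From mathcomp Require Import boolp.

Set Implicit Arguments.
Unset Strict Implicit.
Unset Printing Implicit Defensive.

(* Arcs form a type of their own, so parallel arcs are allowed. *)
Record digraph := Digraph {
  vertices : finType;
  arcs : finType;
  arc_tail : arcs -> vertices;
  arc_head : arcs -> vertices;
  loopless : forall a, arc_tail a != arc_head a
}.

(* Arcs are pairwise distinct, but vertices may repeat. The empty sequence has
   no endpoints, hence is not a path between any two vertices. *)
Definition is_path (D : digraph) (s s' : vertices D) (p : seq (arcs D)) : bool :=
  if p is a :: q then
    [&& uniq p, path (fun b c => arc_head b == arc_tail c) a q,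
        arc_tail a == s & arc_head (last a q) == s']
  else false.

Definition arc_disjoint (D : digraph) (I : Type) (P : I -> seq (arcs D)) : Prop :=
  forall i j : I, i <> j -> forall a : arcs D, a \in P i -> a \notin P j.

Definition disjoint_paths (D : digraph) (x y : vertices D) (m : nat) : Prop :=
  exists P : 'I_m -> seq (arcs D),
    (forall i, is_path x y (P i)) /\ arc_disjoint P.

(* Bounding m by the number of arcs loses nothing, since paths are nonempty:
   see mu_attained and mu_max. *)
Definition mu (D : digraph) (x y : vertices D) : nat :=
  \max_(m < #|arcs D|.+1 | `[< disjoint_paths x y m >]) m.

Lemma disjoint_paths_leq (D : digraph) (x y : vertices D) (m : nat) :
  disjoint_paths x y m -> m <= #|arcs D|.
Proof.
case=> P [pathP disjP].
have arcP i : {a | a \in P i}.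
  by move: (pathP i); case: (P i) => // a q _; exists a; rewrite mem_head.
rewrite -[m in m <= _]card_ord.
apply: (leq_card (fun i => sval (arcP i))) => i j eq_ij.
apply/eqP/contraT => /eqP /disjP/(_ _ (svalP (arcP i))).
by rewrite eq_ij (svalP (arcP j)).
Qed.

Lemma mu_attained (D : digraph) (x y : vertices D) : disjoint_paths x y (mu x y).
Proof.
have dp0 : disjoint_paths x y 0 by exists (fun _ => [::]); split; case.
rewrite /mu; apply: (big_ind (disjoint_paths x y)) => // [m n ? ?|i /asboolP //].
by rewrite /maxn; case: ifP.
Qed.

Lemma mu_max (D : digraph) (x y : vertices D) (m : nat) :
  disjoint_paths x y m -> m <= mu x y.
Proof.
move=> dpm; have lt_m : m < #|arcs D|.+1 by apply: disjoint_paths_leq dpm.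
have dp_asb : `[< disjoint_paths x y (Ordinal lt_m) >] by apply/asboolP.
exact: (bigmax_sup (Ordinal lt_m)).
Qed.

Definition immersed (H D : digraph) : Prop :=
  exists (f : vertices H -> vertices D) (p : arcs H -> seq (arcs D)),
    [/\ injective f,
        (forall a, is_path (f (arc_tail a)) (f (arc_head a)) (p a)) &
        arc_disjoint p].

Section OnionStar.

Variable t : nat.

(* The centre is None, y_i is Some (inl i) and z_i is Some (inr i). *)
Definition onion_vertex : finType := option ('I_t + 'I_t).

Definition onion_x : onion_vertex := None.
Definition onion_y (i : 'I_t) : onion_vertex := Some (inl i).
Definition onion_z (i : 'I_t) : onion_vertex := Some (inr i).

(* The summands are, in order, the arcs y_i x, the arcs x z_i, the arcs x y_i
   and the arcs z_i x; the boolean distinguishes two parallel arcs. *)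
Definition onion_arc : finType :=
  (('I_t + 'I_t) + ('I_t * bool + 'I_t * bool))%type.

Definition onion_tail (a : onion_arc) : onion_vertex :=
  match a with
  | inl (inl i) => onion_y i
  | inl (inr i) => onion_x
  | inr (inl (i, _)) => onion_x
  | inr (inr (i, _)) => onion_z i
  end.

Definition onion_head (a : onion_arc) : onion_vertex :=
  match a with
  | inl (inl i) => onion_x
  | inl (inr i) => onion_z i
  | inr (inl (i, _)) => onion_y i
  | inr (inr (i, _)) => onion_x
  end.

Lemma onion_loopless (a : onion_arc) : onion_tail a != onion_head a.
Proof. by case: a => [[i|i]|[[i b]|[i b]]]. Qed.

Definition onion_star : digraph := Digraph onion_loopless.

End OnionStar.

(* Main.v *)
(** Take many arc-disjoint paths P_i from x to y and Q_j from y to x. If many P_i are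
disjoint from many Q_j, alternative (2) holds; otherwise a stable matching of the P's
with the Q's along their common arcs gives a "stair": matched arcs e_i of P_i and Q_i
such that P_i before e_i never meets Q_j after e_j, so that the closed walks
W_i = (P_i up to e_i, then Q_i) at x are disjoint. What is left over, P_i after e_i and
Q_i before e_i, is linked to the other W_j by further stable matchings. Such a link
leaves a W_i at a vertex which has one path from x and two paths to x (a z-leaf), or
arrives at a vertex which has two paths from x and one to x (a y-leaf). If these
vertices are mostly distinct, they span an onion star centred at x. Otherwise many of
them coincide in a "hub" v, with the paths P[x,v] disjoint from the paths Q[v,x].
Repeating the argument with P[x,v] in place of P either produces a further hub on the
closed walks P[x,v]Q[v,x], or makes P[x,v] disjoint from all of Q, and then one starts
again beyond v. Since 2t hubs on many disjoint closed walks at x give an onion star at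
once, this stops after a bounded number of rounds. *)

Require Import Defs.
From mathcomp Require Import all_boot.
From mathcomp Require Import boolp zify.

Set Implicit Arguments.
Unset Strict Implicit.
Unset Printing Implicit Defensive.

(** * Sequences and finite combinatorics *)

(** In the first matching P prefers its early arcs and Q its late ones. An arc lying before [e_i] on
    [P_i] and after [e_j] on [Q_j] would be preferred by both sides to what they hold, so stability
    forbids it. The leftovers may meet walks inside any chosen index set. Cutting each leftover
    after a fixed number of meetings bounds the out-degree of the meeting relation, so a large index
    set without internal meetings exists; a leftover that was really cut still has enough partners
    outside this set to be matched again. A hub is recorded together with an arc at it common to
    some P and some Q. This arc shows that the hub is not x, and it orders successive hubs: once the
    families are thinned so that no common arc touches the current hub, a common arc at the next hub
    lies off the part already known to be disjoint, so the next hub is strictly farther from x along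
    the path. Reversing all arcs exchanges P with Q and y-leaves with z-leaves, so only one of the
    two cases of cut leftovers is treated directly. *)

Definition dj (T : eqType) (s1 s2 : seq T) : Prop :=
  forall a, a \in s1 -> a \in s2 -> False.

Lemma dj_sym (T : eqType) (s1 s2 : seq T) : dj s1 s2 -> dj s2 s1.
Proof. by move=> h a /[swap]; apply: h. Qed.

Lemma dj_sub (T : eqType) (s1 s2 r1 r2 : seq T) :
  {subset r1 <= s1} -> {subset r2 <= s2} -> dj s1 s2 -> dj r1 r2.
Proof. by move=> h1 h2 h a /h1 + /h2; apply: h. Qed.

Lemma dj_catl (T : eqType) (s1 s2 s : seq T) :
  dj (s1 ++ s2) s <-> dj s1 s /\ dj s2 s.
Proof.
split=> [h|[h1 h2] a]; last by rewrite mem_cat => /orP[]; [apply: h1|apply: h2].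
by split=> a ha; apply: h; rewrite mem_cat ha ?orbT.
Qed.

Lemma dj_catr (T : eqType) (s1 s2 s : seq T) :
  dj s (s1 ++ s2) <-> dj s s1 /\ dj s s2.
Proof.
by split=> [/dj_sym/dj_catl[? ?]|[? ?]]; [split|apply/dj_sym/dj_catl; split]; apply: dj_sym.
Qed.

Lemma dj_revl (T : eqType) (s1 s2 : seq T) : dj (rev s1) s2 <-> dj s1 s2.
Proof. by split=> h a; move: (h a); rewrite mem_rev. Qed.

Lemma dj_revr (T : eqType) (s1 s2 : seq T) : dj s1 (rev s2) <-> dj s1 s2.
Proof. by split=> h a; move: (h a); rewrite mem_rev. Qed.

Lemma uniq_catP (T : eqType) (s1 s2 : seq T) :
  uniq (s1 ++ s2) <-> [/\ uniq s1, uniq s2 & dj s1 s2].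
Proof.
rewrite cat_uniq; split=> [/and3P[-> /hasPn h ->]|[-> -> h]].
  by split=> // a h1 /h; rewrite h1.
by rewrite andbT; apply/hasPn => a h2; apply/negP => h1; apply: (h a).
Qed.

Lemma last_split (T : eqType) (r : pred T) (s : seq T) :
  has r s -> exists s1 f s2, [/\ s = s1 ++ f :: s2, r f & ~~ has r s2].
Proof.
elim: s => //= a s IH; have [/IH[s1 [f [s2 [-> rf hs]]]] _|nh] := boolP (has r s).
  by exists (a :: s1), f, s2.
by rewrite orbF => ra; exists [::], a, s.
Qed.

Lemma first_split (T : eqType) (r : pred T) (s : seq T) :
  has r s -> exists s1 f s2, [/\ s = s1 ++ f :: s2, r f & ~~ has r s1].
Proof.
rewrite -has_rev => /last_split[s1 [f [s2 [/(congr1 rev)]]]].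
rewrite revK rev_cat rev_cons -cats1 -catA /= => -> rf hs.
by exists (rev s2), f, (rev s1); rewrite has_rev.
Qed.

Lemma mem_split (T : eqType) a (s : seq T) :
  a \in s -> exists s1 s2, s = s1 ++ a :: s2.
Proof. by case/splitPr=> s1 s2; exists s1, s2. Qed.

Lemma inj_of_card (I : finType) (A : {set I}) s :
  s <= #|A| -> exists h : 'I_s -> I, injective h /\ forall k, h k \in A.
Proof.
move=> le_s; exists (fun k => enum_val (widen_ord le_s k)); split.
  by move=> k l /enum_val_inj /(congr1 val) /= /val_inj.
by move=> k; apply: enum_valP.
Qed.

Lemma inj_widen s n : s <= n -> exists h : 'I_s -> 'I_n, injective h.
Proof. by move=> le; exists (widen_ord le) => i j /(congr1 val) /= /val_inj. Qed.

Lemma pigeon (I : finType) (V : eqType) (f : I -> V) s h :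
  s * h < #|I| ->
  (exists g : 'I_s -> I, injective (f \o g)) \/
  (exists2 g : 'I_h -> I, injective g & exists v, forall k, f (g k) = v).
Proof.
(* The fibres stand in for the values of [f]: [V] is not finite, whereas the sets [F i] can be
   counted. *)
move=> lt_sh; pose F i := [set j | f j == f i].
have [/existsP[i hi]|/existsPn small] := boolP [exists i, h <= #|F i|].
  right; have [g [injg hg]] := inj_of_card hi.
  by exists g => //; exists (f i) => k; have := hg k; rewrite inE => /eqP.
left; have: s <= #|F @: [set: I]|.
  rewrite leqNgt; apply/negP => lt_s.
  have le_I: #|I| <= \sum_(v in F @: [set: I]) h.
    rewrite -cardsT -sum1_card (partition_big_imset F) /=.
    apply: leq_sum => v /imsetP[i _ ->]; rewrite sum1_card.
    apply: leq_trans (ltnW _); last by rewrite ltnNge; apply: small i.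
    apply: subset_leq_card; apply/subsetP => j /andP[_ /eqP eqF].
    by rewrite -eqF inE.
  move: le_I; rewrite sum_nat_const leqNgt => /negP; apply.
  by apply: leq_ltn_trans lt_sh; rewrite leq_mul2r ltnW ?orbT.
case/inj_of_card=> g [injg hg].
have hg' k : exists i, F i == g k by have /imsetP[i _ ->] := hg k; exists i.
exists (fun k => xchoose (hg' k)) => k l /= eq_f; apply: injg.
rewrite -(eqP (xchooseP (hg' k))) -(eqP (xchooseP (hg' l))).
by apply/setP => j; rewrite !inE eq_f.
Qed.

(** Greedy choice. In every subset the in-degrees sum to at most [d] times its size, so some vertex
    has at most [d] in-neighbours there; choosing it discards itself, these and at most [d]
    out-neighbours, [2 * d + 1] vertices in all. *)
Lemma indep (I : finType) (R : rel I) d s :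
  irreflexive R -> (forall i, #|[set j | R i j]| <= d) -> (2 * d + 1) * s <= #|I| ->
  exists2 g : 'I_s -> I, injective g & forall k l, ~~ R (g k) (g l).
Proof.
move=> Rirr outR le_s.
suff [B [_ cardB indB]] : exists B : {set I},
    [/\ B \subset [set: I], #|B| = s & {in B &, forall i j, ~~ R i j}].
  have [g [injg hg]] : exists h : 'I_s -> I, injective h /\ forall k, h k \in B.
    by apply: inj_of_card; rewrite cardB.
  by exists g => // k l; apply: indB.
have: (2 * d + 1) * s <= #|[set: I]| by rewrite cardsT.
move: [set: I] => A; elim: s A {le_s} => [|s IH] A leA.
  by exists set0; rewrite cards0 sub0set; split=> // i j; rewrite inE.
have A_gt0 : 0 < #|A| by apply: leq_trans leA; rewrite muln_gt0 addn1.
have [i iA in_i] : exists2 i, i \in A & #|[set j in A | R j i]| <= d.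
  apply/exists_inP/contraT => /exists_inPn big_in.
  have: \sum_(i in A) \sum_(j in A) R j i <= #|A| * d.
    rewrite exchange_big /= -sum_nat_const; apply: leq_sum => i iA.
    apply: leq_trans (outR i); rewrite -sum1_card big_mkcond [leqRHS]big_mkcond /=.
    by apply: leq_sum => j _; rewrite inE; case: (j \in A); case: (R i j).
  rewrite leqNgt => /negP[]; rewrite -sum_nat_const.
  have {}big_in i : i \in A -> d < \sum_(j in A) R j i.
    move/big_in; rewrite -ltnNge; move/leq_trans; apply.
    rewrite -sum1_card big_mkcond [leqRHS]big_mkcond /=.
    by apply: leq_sum => j _; rewrite inE; case: (j \in A); case: (R j i).
  have -> : \sum_(i in A) d = (\sum_(i in A) d.+1) - #|A|.
    by rewrite !sum_nat_const mulnS addKn.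
  rewrite ltn_subLR //; last by rewrite sum_nat_const leq_pmulr.
  apply: (@leq_ltn_trans (\sum_(i in A) \sum_(j in A) R j i)).
    by apply: leq_sum => i /big_in.
  by rewrite -[ltnLHS]add0n ltn_add2r.
pose N := i |: ([set j | R i j] :|: [set j in A | R j i]).
have cardN : #|N| <= 2 * d + 1.
  rewrite cardsU1 addnC; apply: leq_add; last by case: (_ \notin _).
  by rewrite mul2n -addnn; apply: leq_trans (leq_card_setU _ _) (leq_add (outR i) in_i).
have [|B [subB cardB indB]] := IH (A :\: N).
  rewrite cardsD; move: leA; rewrite mulnS.
  have := subset_leq_card (subsetIr A N); lia.
have iB : i \notin B.
  by apply/negP => /(subsetP subB); rewrite !inE eqxx.
exists (i |: B); split.
- rewrite subUset sub1set iA; apply: subset_trans subB _; exact: subsetDl.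
- by rewrite cardsU1 iB cardB.
have notN j : j \in B -> ~~ R i j /\ ~~ R j i.
  move/(subsetP subB); rewrite !inE => /andP[+ jA]; rewrite jA !negb_or.
  by case/and3P.
move=> j l /setU1P[->|jB] /setU1P[->|lB].
- by rewrite Rirr.
- by case: (notN l lB).
- by case: (notN j jB).
- exact: indB.
Qed.

(** If fewer than [n] indices are rich, [m] poor ones can be chosen; together they are related to at
    most [m * n] elements of [J], and [m] others remain. *)
Lemma rich_or_poor (I J : finType) (R : I -> J -> bool) n m :
  n + m <= #|I| -> m * n + m <= #|J| ->
  (exists2 g : 'I_n -> I, injective g & forall k, n <= #|[set j | R (g k) j]|) \/
  (exists g : 'I_m -> I, exists h : 'I_m -> J,
    [/\ injective g, injective h & forall k l, ~~ R (g k) (h l)]).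
Proof.
move=> leI leJ; pose A := [set i | n <= #|[set j | R i j]|].
have [/inj_of_card[g [injg hg]]|ltA] := leqP n #|A|.
  by left; exists g => // k; have := hg k; rewrite inE.
right; have /inj_of_card[g [injg hg]] : m <= #|~: A|.
  by have := cardsC A; lia.
have : m <= #|~: \bigcup_k [set j | R (g k) j]|.
  have : #|\bigcup_k [set j | R (g k) j]| <= m * n.
    rewrite -[X in _ <= X * _]card_ord -sum_nat_const.
    elim/big_rec2: _ => [|k c B _ leB]; first by rewrite cards0.
    apply: leq_trans (leq_card_setU _ _) (leq_add _ leB).
    by have := hg k; rewrite !inE -ltnNge => /ltnW.
  have := cardsC (\bigcup_k [set j | R (g k) j]); lia.
case/inj_of_card=> h [injh hh]; exists g, h; split=> // k l; apply/negP => Rkl.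
by have := hh l; rewrite inE => /bigcupP; apply; exists k => //; rewrite inE.
Qed.

(** * Truncation of sequences, and stable matching along common elements *)

Definition hits (T : eqType) (s1 s2 : seq T) := has (mem s2) s1.

Lemma hitsP (T : eqType) (s1 s2 : seq T) :
  reflect (exists2 a, a \in s1 & a \in s2) (hits s1 s2).
Proof. exact: hasP. Qed.

Lemma hitsPn (T : eqType) (s1 s2 : seq T) : reflect (dj s1 s2) (~~ hits s1 s2).
Proof.
by apply: (iffP hasPn) => [h a /h/negP //|h a h1]; apply/negP => h2; apply: (h a).
Qed.

(** The [F j] are disjoint, so one more element hits at most one more of them and the count can be
    stopped exactly at [d]. The upper bound is the out-degree needed for [indep]; equality leaves a
    cut sequence with enough partners for [linking]. *)
Lemma trunc_prefix (T : eqType) (J : finType) (F : J -> seq T) d (s : seq T) :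
  (forall j l a, a \in F j -> a \in F l -> j = l) ->
  exists s1 s2, [/\ s = s1 ++ s2, #|[set j | hits s1 (F j)]| <= d &
    s2 = [::] \/ #|[set j | hits s1 (F j)]| = d].
Proof.
move=> djF; elim/last_ind: s => [|s a [s1 [s2 [-> le1 h2]]]].
  exists [::], [::]; split=> //; last by left.
  by rewrite (_ : [set j | _] = set0) ?cards0 //; apply/setP => j; rewrite !inE.
case: h2 => [->|h2]; last first.
  by exists s1, (rcons s2 a); rewrite rcons_cat; split=> //; right.
rewrite cats0; have [le2|gt2] := leqP #|[set j | hits (rcons s1 a) (F j)]| d.
  by exists (rcons s1 a), [::]; rewrite cats0; split=> //; left.
exists s1, [:: a]; rewrite cats1; split=> //; right.
apply/eqP; rewrite eqn_leq le1 -ltnS (leq_trans gt2) //.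
have -> : [set j | hits (rcons s1 a) (F j)] = [set j | a \in F j] :|: [set j | hits s1 (F j)].
  by apply/setP => j; rewrite !inE /hits has_rcons.
apply: leq_trans (leq_card_setU _ _) _; rewrite -add1n leq_add2r.
by apply/card_le1_eqP => j l; rewrite !inE => ? ?; apply: djF; eassumption.
Qed.

Lemma trunc_suffix (T : eqType) (J : finType) (F : J -> seq T) d (s : seq T) :
  (forall j l a, a \in F j -> a \in F l -> j = l) ->
  exists s1 s2, [/\ s = s1 ++ s2, #|[set j | hits s2 (F j)]| <= d &
    s1 = [::] \/ #|[set j | hits s2 (F j)]| = d].
Proof.
move=> /(trunc_prefix d (rev s))[s1 [s2 [eqs le1 h2]]].
have e : [set j | hits (rev s1) (F j)] = [set j | hits s1 (F j)].
  by apply/setP => j; rewrite !inE /hits has_rev.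
exists (rev s2), (rev s1); rewrite e; split=> //; first by rewrite -rev_cat -eqs revK.
by case: h2 => [->|]; [left|right].
Qed.

(* Gale-Shapley, with the A's proposing: each A i prefers its early elements and
   each B j its late ones. A pointer [n i] records how many proposals of A i have
   been rejected. *)
Section Linking.

Variables (T : eqType) (I J : finType) (A : I -> seq T) (B : J -> seq T).
Hypothesis djA : forall i j a, a \in A i -> a \in A j -> i = j.
Hypothesis djB : forall i j a, a \in B i -> a \in B j -> i = j.
Hypothesis uniqB : forall j, uniq (B j).

Definition proposal (n : I -> nat) i c := ohead (drop (n i) (A i)) == Some c.

(** The invariant of the algorithm: whoever has rejected an element now holds a proposal that it
    likes better. *)
Definition rejections_justified (n : I -> nat) := forall i e j,
  e \in take (n i) (A i) -> e \in B j ->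
  exists i' c, [/\ proposal n i' c, c \in B j & index e (B j) < index c (B j)].

Definition no_rejection (n : I -> nat) :=
  (forall i c, proposal n i c -> exists j, c \in B j) /\
  (forall i i' c c' j, proposal n i c -> proposal n i' c' ->
    c \in B j -> c' \in B j -> i = i').

Lemma proposal_mem n i c : proposal n i c -> c \in A i.
Proof.
rewrite /proposal; case e: (drop _ _) => [|a s] //= /eqP[<-].
by rewrite (mem_drop (n0 := n i)) // e mem_head.
Qed.

(** The condition on [c] covers both grounds for rejection: it is vacuous if [c] lies on no [B j],
    and otherwise names a better competitor. An older rejection that was justified by [c] itself is
    now justified by this competitor. *)
Lemma advance n i c : rejections_justified n -> proposal n i c ->
  (forall j, c \in B j -> exists i' c',
     [/\ i' != i, proposal n i' c', c' \in B j & index c (B j) < index c' (B j)]) ->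
  rejections_justified (fun l => if l == i then (n l).+1 else n l).
Proof.
move=> jn pc cj i1 e j e_rej eB.
have pres i' c' : i' != i -> proposal n i' c' ->
    proposal (fun l => if l == i then (n l).+1 else n l) i' c'.
  by rewrite /proposal => /negPf->.
have old : e \in take (n i1) (A i1) \/ i1 = i /\ e = c.
  move: e_rej; case: eqP => [->|_]; last by left.
  move: pc; rewrite /proposal; case ed: (drop _ _) => [|a s] //= /eqP[<-].
  have -> : take (n i).+1 (A i) = rcons (take (n i) (A i)) a.
    rewrite -[in LHS](cat_take_drop (n i) (A i)) ed take_cat size_take.
    have -> : n i < size (A i) by rewrite ltnNge -subn_eq0 -size_drop ed.
    by rewrite ltnNge leqnSn /= subSnn /= take0 cats1.
  by rewrite mem_rcons inE => /orP[/eqP->|]; [right|left].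
case: old => [old|[_ ?]]; last first.
  subst e; have [i' [c' [ne p' c'B lt']]] := cj _ eB.
  by exists i', c'; split=> //; apply: pres.
have [i' [c' [p' c'B lt']]] := jn _ _ _ old eB.
have [ii'|ne] := eqVneq i' i; last by exists i', c'; split=> //; apply: pres.
have ? : c' = c by move: p' pc; rewrite ii' /proposal => /eqP-> /eqP[].
subst c' i'; have [i' [c' [ne p'' c'B' lt'']]] := cj _ c'B.
by exists i', c'; split=> //; [apply: pres|apply: ltn_trans lt''].
Qed.

(** Each rejection uses up one element of some [A i], so the number of elements not yet rejected
    decreases until no rejection is possible. *)
Lemma stable_pointers : exists2 n, rejections_justified n & no_rejection n.
Proof.
have: exists2 n : I -> nat, rejections_justified n & \sum_i (size (A i) - n i) <= \sum_i size (A i).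
  exists (fun _ => 0); first by move=> i e j; rewrite take0.
  by apply: leq_sum => i _; rewrite subn0.
move: (\sum_i size (A i)) => N; elim/ltn_ind: N => N IH [n jn leN].
have [stable|] := pselect (no_rejection n); first by exists n.
move=> unstable.
suff [i [c [pc cj]]] : exists i c, proposal n i c /\
  forall j, c \in B j -> exists i' c',
     [/\ i' != i, proposal n i' c', c' \in B j & index c (B j) < index c' (B j)].
  have lt_sum : \sum_l (size (A l) - (if l == i then (n l).+1 else n l)) <
      \sum_l (size (A l) - n l).
    rewrite (bigD1 i) //= [ltnRHS](bigD1 i) //= eqxx -addSn; apply: leq_add.
      rewrite subnS prednK // subn_gt0 ltnNge; apply/negP => le_n.
      by move: pc; rewrite /proposal drop_oversize.
    by apply: leq_sum => l /negPf->.
  apply: (IH _ (leq_trans lt_sum leN)).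
  by exists (fun l => if l == i then (n l).+1 else n l) => //; apply: (advance jn pc).
apply: contrapT => none; apply: unstable; split=> [i c pc|i i' c c' j pc pc' cB c'B].
  apply: contrapT => noB; apply: none; exists i, c; split=> // j cB.
  by case: noB; exists j.
apply: contrapT => ne; wlog lt_cc' : i i' c c' pc pc' cB c'B ne / index c (B j) < index c' (B j).
  move=> W; have [lt|lt|eq_i] := ltngtP (index c (B j)) (index c' (B j)).
  - exact: (W i i' c c').
  - by apply: (W i' i c' c) => // /esym.
  apply: ne; apply: (djA (a := c)); first exact: proposal_mem pc.
  rewrite -(nth_index c cB) eq_i nth_index //; exact: proposal_mem pc'.
apply: none; exists i, c; split=> // l cl; exists i', c'.
have -> : l = j by apply: djB cl cB.
by split=> //; apply/eqP => /esym.
Qed.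

(** An element of [a k] on [B (h l)] was rejected in favour of a later one, and what [B (h l)] holds
    is [c l]; hence it cannot lie in [b' l]. For the number of pairs: either every [A i] is matched,
    or some [A i0] has been rejected throughout, and then each of the at least [d] sequences [B j]
    that it hits holds a proposal. *)
Lemma linking d : d <= #|I| -> (forall i, d <= #|[set j | hits (A i) (B j)]|) ->
  exists (g : 'I_d -> I) (h : 'I_d -> J) (a a' b b' : 'I_d -> seq T) (c : 'I_d -> T),
  [/\ injective g, injective h,
      (forall k, A (g k) = a k ++ c k :: a' k),
      (forall k, B (h k) = b k ++ c k :: b' k) &
      forall k l, dj (a k) (b' l)].
Proof.
move=> le_d hitsA; have [n jn [inB uniqj]] := stable_pointers.
pose M := [set i | n i < size (A i)].
have propM i : i \in M -> exists c j, proposal n i c /\ c \in B j.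
  rewrite inE /proposal; case ed: (drop (n i) (A i)) => [|c s] /=.
    by rewrite ltnNge -subn_eq0 -size_drop ed.
  have pc : proposal n i c by rewrite /proposal ed.
  by case: (inB _ _ pc) => j cj _; exists c, j.
have inM i c : proposal n i c -> i \in M.
  rewrite /proposal inE ltnNge; apply: contraTN => le_n.
  by rewrite drop_oversize.
have le_dM : d <= #|M|.
  have [/eqP eqM|] := boolP (M == setT); first by rewrite eqM cardsT.
  rewrite -subTset => /subsetPn[i0 _ i0M].
  apply: leq_trans (hitsA i0) _.
  (* The index whose proposal [B j] holds. The default is never taken for a [B j] hit by [A i0]; on
     those, [phi] is injective because a proposal lies on only one [B j]. *)
  pose phi j := odflt i0 [pick i in M | [exists k : 'I_(size (A i)),
    proposal n i (tnth (in_tuple (A i)) k) && (tnth (in_tuple (A i)) k \in B j)]].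
  have phiP j : hits (A i0) (B j) -> phi j \in M /\ exists2 c, proposal n (phi j) c & c \in B j.
    case/hitsP=> e eA eB.
    have [i' [c [pc cB _]]] : exists i' c, [/\ proposal n i' c, c \in B j & index e (B j) < index c (B j)].
      apply: jn eB; rewrite take_oversize; first exact: eA.
      by move: i0M; rewrite inE -leqNgt.
    rewrite /phi; case: pickP => [i /andP[iM /existsP[k /andP[pk kB]]]|/(_ i')] /=.
      by split=> //; exists (tnth (in_tuple (A i)) k).
    rewrite (inM _ _ pc) /= => /existsP[].
    have /(@tnthP _ _ (in_tuple _)) [k ek] := proposal_mem pc.
    by exists k; rewrite -ek pc.
  rewrite -(card_in_imset (f := phi)).
    apply: subset_leq_card; apply/subsetP => i /imsetP[j]; rewrite inE => /phiP[h _] ->.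
    exact: h.
  move=> j l; rewrite !inE => /phiP[_ [c pc cB]] /phiP[_ [c' pc' c'B]] eq_phi.
  move: pc pc'; rewrite eq_phi /proposal => /eqP-> /eqP[] ecc.
  by apply: djB cB _; rewrite ecc.
have [g [injg gM]] := inj_of_card le_dM.
have /choice[c cP] k : exists c, exists j, proposal n (g k) c /\ c \in B j by apply: propM.
have /choice[h hP] k := cP k.
have splitA k : A (g k) = take (n (g k)) (A (g k)) ++ c k :: behead (drop (n (g k)) (A (g k))).
  rewrite -[in LHS](cat_take_drop (n (g k)) (A (g k))); congr (_ ++ _).
  by case: (hP k); rewrite /proposal; case: (drop _ _) => //= x s /eqP[->].
have /choice[bb bbP] k : exists bb, B (h k) = bb.1 ++ c k :: bb.2.
  by have [_ /mem_split[s1 [s2 ->]]] := hP k; exists (s1, s2).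
have injh : injective h.
  move=> k l eq_h; apply: injg; have [pk kB] := hP k; have [pl lB] := hP l.
  by apply: (uniqj _ _ _ _ _ pk pl kB); rewrite eq_h.
exists g, h, (fun k => take (n (g k)) (A (g k))),
  (fun k => behead (drop (n (g k)) (A (g k)))), (fun k => (bb k).1), (fun k => (bb k).2), c.
split=> // k l e e_rej e_late.
have eB : e \in B (h l) by rewrite bbP mem_cat inE e_late !orbT.
have [i' [c' [p' c'B lt']]] := jn _ _ _ e_rej eB.
have [pl lB] := hP l.
have ii' := uniqj _ _ _ _ _ p' pl c'B lB; subst i'.
have ecc : c' = c l by move: p' pl; rewrite /proposal => /eqP-> /eqP[].
move: lt'; rewrite ecc bbP !index_cat.
have := uniqB (h l); rewrite bbP => /uniq_catP[_ /= /andP[cnot ub] djb].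
have -> : (e \in (bb l).1) = false.
  by apply/negP => /djb; apply; rewrite inE e_late orbT.
have -> : (c l \in (bb l).1) = false by apply/negP => /djb; apply; apply: mem_head.
by rewrite /= eqxx addn0 ltnNge leq_addr.
Qed.

End Linking.

(** Emptying [B j] for [j] in [E] excludes it from the matching, since a matched sequence contains
    its [c k]. *)
Lemma linking_out (T : eqType) (I J : finType) (A : I -> seq T) (B : J -> seq T)
    (E : {set J}) d :
  (forall i j a, a \in A i -> a \in A j -> i = j) ->
  (forall i j a, a \in B i -> a \in B j -> i = j) ->
  (forall j, uniq (B j)) -> d <= #|I| ->
  (forall i, d <= #|[set j | (j \notin E) && hits (A i) (B j)]|) ->
  exists (g : 'I_d -> I) (h : 'I_d -> J) (a a' b b' : 'I_d -> seq T) (c : 'I_d -> T),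
  [/\ injective g, injective h /\ (forall k, h k \notin E),
      (forall k, A (g k) = a k ++ c k :: a' k),
      (forall k, B (h k) = b k ++ c k :: b' k) &
      forall k l, dj (a k) (b' l)].
Proof.
move=> djA djB uB le_d hitsA; pose B' j := if j \in E then [::] else B j.
have [||||g [h [a [a' [b [b' [c [injg injh eA eB djab]]]]]]]] := @linking _ _ _ A B' _ _ _ d le_d.
- exact: djA.
- by move=> i j e; rewrite /B'; case: ifP; case: ifP => // _ _; apply: djB.
- by move=> j; rewrite /B'; case: ifP.
- move=> i; apply: leq_trans (hitsA i) _; apply: subset_leq_card.
  by apply/subsetP => j; rewrite !inE /B' => /andP[/negPf-> ->].
have hE k : h k \notin E.
  by apply/negP => hk; have := eB k; rewrite /B' hk; case: (b k).
exists g, h, a, a', b, b', c; split=> // k.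
by rewrite -eB /B' (negPf (hE k)).
Qed.

(** * Walks, leaves and onion stars *)

Notation heads := (map (@arc_head _)).
Notation tails := (map (@arc_tail _)).

Section Walks.

Variable D : digraph.
Implicit Types (x y z v : vertices D) (a e f : arcs D) (p q s : seq (arcs D)).

Fixpoint walk x y p : bool :=
  if p is a :: q then (arc_tail a == x) && walk (arc_head a) y q else x == y.

Lemma walk_cat x y z p q : walk x y p -> walk y z q -> walk x z (p ++ q).
Proof. by elim: p x => [|a p IH] x /= => [/eqP-> //|/andP[-> /IH]]; apply. Qed.

Lemma walk_catP x z p q : walk x z (p ++ q) -> exists2 y, walk x y p & walk y z q.
Proof.
elim: p x => [|a p IH] x /=; first by exists x.
by case/andP=> -> /IH[y]; exists y.
Qed.

Lemma walk_tail x z p a q :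
  walk x z (p ++ a :: q) -> walk x (arc_tail a) p /\ walk (arc_tail a) z (a :: q).
Proof. by case/walk_catP=> y wp /= /andP[/eqP-> wq]; rewrite eqxx. Qed.

Lemma walk_head x z p a q :
  walk x z (p ++ a :: q) -> walk x (arc_head a) (p ++ [:: a]) /\ walk (arc_head a) z q.
Proof.
rewrite -cat1s catA => /walk_catP[y wpa wq].
by have [y' _ /= /andP[_ /eqP ey]] := walk_catP wpa; rewrite ey.
Qed.

(** The vertex sequence read in two ways; it transfers simplicity from heads to tails. *)
Lemma walk_verts x y p : walk x y p -> x :: heads p = rcons (tails p) y.
Proof. by elim: p x => [|a p IH] x /= => [/eqP->|/andP[/eqP<- /IH->]]. Qed.

Lemma walk_simple x y p : walk x y p ->
  exists q, [/\ {subset q <= p}, walk x y q & uniq (x :: heads q)].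
Proof.
elim: p x => [|a p IH] x /=; first by exists [::].
case/andP=> /eqP ax /IH[q [sub wq uq]].
have sub' : {subset q <= a :: p} by move=> b /sub; rewrite inE orbC => ->.
have [/mapP[b /mem_split[q1 [q2 eq_q]] xb]|xq] := boolP (x \in heads q).
  exists q2; split.
  - by move=> c cq; apply: sub'; rewrite eq_q mem_cat inE cq !orbT.
  - by rewrite xb; move: wq; rewrite eq_q => /walk_head[].
  - rewrite xb; move: uq; rewrite eq_q /= map_cat /= => /andP[_].
    by rewrite cat_uniq => /and3P[].
exists (a :: q); split.
- by move=> b; rewrite !inE => /orP[->//|/sub->]; rewrite orbT.
- by rewrite /= ax eqxx.
- rewrite /= in uq *; rewrite uq inE negb_or xq !andbT -ax.
  exact: loopless.
Qed.

Lemma walk_is_path x y p : walk x y p -> x != y ->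
  exists2 q, {subset q <= p} & is_path x y q.
Proof.
move=> /walk_simple[q [sub wq uq]] ne; exists q => //.
have {uq} uq : uniq q by move: uq => /= /andP[_ /map_uniq].
case: q wq uq {sub} => [|a q] /=; first by rewrite (negPf ne).
move=> /andP[-> wq] ->; rewrite /=.
elim: q a wq => [|b q IH] a /= => [->//|/andP[/eqP e /IH/andP[-> ->]]].
by rewrite e eqxx.
Qed.

Lemma is_path_walk x y p : is_path x y p -> walk x y p.
Proof.
case: p => //= a q /and4P[_ pq -> /=]; elim: q a pq => [|b q IH] a /= => [_ ->//|].
by case/andP=> /eqP-> /IH{}IH /IH; rewrite eqxx.
Qed.

(** What the centre [x] requires of the image [v] of some [y_i]. The list [s] is a reservoir of
    arcs, so that different leaves are kept apart by comparing reservoirs only; the walks are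
    shortened to paths in [yleaf_paths]. *)
Definition yleaf x v s := exists s1 s2 s3,
  [/\ walk x v s1, walk x v s2, walk v x s3,
      {subset s1 <= s} /\ {subset s2 <= s} /\ {subset s3 <= s} &
      dj s1 s2 /\ dj s1 s3 /\ dj s2 s3].

Definition zleaf x v s := exists s1 s2 s3,
  [/\ walk v x s1, walk v x s2, walk x v s3,
      {subset s1 <= s} /\ {subset s2 <= s} /\ {subset s3 <= s} &
      dj s1 s2 /\ dj s1 s3 /\ dj s2 s3].

Lemma yleaf_paths x v s : x != v -> yleaf x v s -> exists P : option bool -> seq (arcs D),
  [/\ forall b, is_path x v (P (Some b)), is_path v x (P None),
      arc_disjoint P & forall o, {subset P o <= s}].
Proof.
move=> ne [s1 [s2 [s3 [w1 w2 w3 [sub1 [sub2 sub3]] [d12 [d13 d23]]]]]].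
have [q1 sq1 p1] := walk_is_path w1 ne.
have [q2 sq2 p2] := walk_is_path w2 ne.
rewrite eq_sym in ne; have [q3 sq3 p3] := walk_is_path w3 ne.
have {}d12 := dj_sub sq1 sq2 d12; have {}d13 := dj_sub sq1 sq3 d13.
have {}d23 := dj_sub sq2 sq3 d23.
exists (fun o => match o with Some true => q1 | Some false => q2 | None => q3 end).
split=> //.
- by case.
- move=> [[]|] [[]|] // _ a ha; apply/negP => hb;
    by [apply: (d12 a)|apply: (d13 a)|apply: (d23 a)].
- by case=> [[]|] a; [move/sq1/sub1|move/sq2/sub2|move/sq3/sub3].
Qed.

Lemma zleaf_paths x v s : x != v -> zleaf x v s -> exists P : option bool -> seq (arcs D),
  [/\ forall b, is_path v x (P (Some b)), is_path x v (P None),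
      arc_disjoint P & forall o, {subset P o <= s}].
Proof.
move=> ne [s1 [s2 [s3 [w1 w2 w3 [sub1 [sub2 sub3]] [d12 [d13 d23]]]]]].
have [q3 sq3 p3] := walk_is_path w3 ne.
rewrite eq_sym in ne; have [q1 sq1 p1] := walk_is_path w1 ne.
have [q2 sq2 p2] := walk_is_path w2 ne.
have {}d12 := dj_sub sq1 sq2 d12; have {}d13 := dj_sub sq1 sq3 d13.
have {}d23 := dj_sub sq2 sq3 d23.
exists (fun o => match o with Some true => q1 | Some false => q2 | None => q3 end).
split=> //.
- by case.
- move=> [[]|] [[]|] // _ a ha; apply/negP => hb;
    by [apply: (d12 a)|apply: (d13 a)|apply: (d23 a)].
- by case=> [[]|] a; [move/sq1/sub1|move/sq2/sub2|move/sq3/sub3].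
Qed.

Lemma immersed_leaves t x (y z : 'I_t -> vertices D) (Y Z : 'I_t -> seq (arcs D)) :
  injective y -> injective z -> (forall i j, y i != z j) ->
  (forall i, x != y i) -> (forall i, x != z i) ->
  (forall i, yleaf x (y i) (Y i)) -> (forall i, zleaf x (z i) (Z i)) ->
  (forall i j, i <> j -> dj (Y i) (Y j)) -> (forall i j, i <> j -> dj (Z i) (Z j)) ->
  (forall i j, dj (Y i) (Z j)) ->
  immersed (onion_star t) D.
Proof.
move=> injy injz yz xy xz ly lz djY djZ djYZ.
have /choice[PY hY] i := yleaf_paths (xy i) (ly i).
have /choice[PZ hZ] i := zleaf_paths (xz i) (lz i).
pose f (u : onion_vertex t) := match u with
  | None => x | Some (inl i) => y i | Some (inr i) => z i end.
pose p (a : onion_arc t) := match a with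
  | inl (inl i) => PY i None
  | inl (inr i) => PZ i None
  | inr (inl (i, b)) => PY i (Some b)
  | inr (inr (i, b)) => PZ i (Some b) end.
pose key (a : onion_arc t) : ('I_t + 'I_t) * option bool := match a with
  | inl (inl i) => (inl i, None)
  | inl (inr i) => (inr i, None)
  | inr (inl (i, b)) => (inl i, Some b)
  | inr (inr (i, b)) => (inr i, Some b) end.
pose P (k : ('I_t + 'I_t) * option bool) := match k.1 with inl i => PY i k.2 | inr i => PZ i k.2 end.
have pP (a : onion_arc t) : p a = P (key a) by case: a => [[]|[[]|[]]].
have inj_key : injective key by case=> [[i|i]|[[i b]|[i b]]] [[j|j]|[[j c]|[j c]]] // [->] // ->.
have djP (k l : ('I_t + 'I_t) * option bool) : k <> l -> dj (P k) (P l).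
  case: k l => [[i|i] o] [[j|j] o'] ne a; rewrite /P /=.
  - case: (hY i) (hY j) => _ _ dY subY [_ _ _ subY'].
    have [ij|/eqP ij] := eqVneq i j; last by move=> /subY + /subY'; apply: djY.
    subst j; move=> h1 h2; have /dY : o <> o' by move=> e; apply: ne; rewrite e.
    by move/(_ a h1); rewrite h2.
  - by case: (hY i) (hZ j) => _ _ _ subY [_ _ _ subZ] /subY + /subZ; apply: djYZ.
  - by case: (hZ i) (hY j) => _ _ _ subZ [_ _ _ subY] /subZ + /subY => /[swap]; apply: djYZ.
  - case: (hZ i) (hZ j) => _ _ dZ subZ [_ _ _ subZ'].
    have [ij|/eqP ij] := eqVneq i j; last by move=> /subZ + /subZ'; apply: djZ.
    subst j; move=> h1 h2; have /dZ : o <> o' by move=> e; apply: ne; rewrite e.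
    by move/(_ a h1); rewrite h2.
exists f, p; split.
- case=> [[i|i]|] [[j|j]|] //= /eqP; rewrite ?(inj_eq injy) ?(inj_eq injz).
  + by move/eqP->.
  + by rewrite (negPf (yz _ _)).
  + by rewrite eq_sym (negPf (xy _)).
  + by rewrite eq_sym (negPf (yz _ _)).
  + by move/eqP->.
  + by rewrite eq_sym (negPf (xz _)).
  + by rewrite (negPf (xy _)).
  + by rewrite (negPf (xz _)).
- case=> [[i|i]|[[i b]|[i b]]] /=.
  + by case: (hY i).
  + by case: (hZ i).
  + by case: (hY i).
  + by case: (hZ i).
- move=> a b ne c; rewrite !pP => ha; apply/negP => hb.
  by apply: (djP (key a) (key b)) ha hb => /inj_key.
Qed.

(* All disjointness is only asked for distinct indices: half of the indices will
   serve for the y-leaves and the other half for the z-leaves. *)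
Lemma immersed_thin t n x (y z : 'I_n -> vertices D) (Y Z : 'I_n -> seq (arcs D)) :
  3 * (t + t) <= n -> injective y -> injective z ->
  (forall i, x != y i) -> (forall i, x != z i) ->
  (forall i, yleaf x (y i) (Y i)) -> (forall i, zleaf x (z i) (Z i)) ->
  (forall i j, i <> j -> dj (Y i) (Y j)) -> (forall i j, i <> j -> dj (Z i) (Z j)) ->
  (forall i j, i <> j -> dj (Y i) (Z j)) ->
  immersed (onion_star t) D.
Proof.
move=> le_n injy injz xy xz ly lz djY djZ djYZ.
(* As [z] is injective, each [i] clashes with at most one [j]; out-degree 1 gives the factor
   [2 * 1 + 1] in the bound. *)
have [|i||g injg hg] := @indep 'I_n (fun i j => (i != j) && (y i == z j)) 1 (t + t).
- by move=> i; rewrite eqxx.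
- apply/card_le1_eqP => j k; rewrite !inE => /andP[_ /eqP e1] /andP[_ /eqP e2].
  by apply: injz; rewrite -e1 -e2.
- by rewrite card_ord.
have neg k l : g (lshift t k) <> g (rshift t l).
  by move=> /injg /eqP; rewrite eq_lrshift.
apply: (@immersed_leaves t x (fun i => y (g (lshift t i))) (fun i => z (g (rshift t i)))
  (fun i => Y (g (lshift t i))) (fun i => Z (g (rshift t i)))) => //.
- by move=> i j /injy /injg /lshift_inj.
- by move=> i j /injz /injg /rshift_inj.
- move=> i j; have := hg (lshift t i) (rshift t j).
  by rewrite negb_and negbK => /orP[/eqP/neg//|].
- by move=> i j ne; apply: djY => /injg /lshift_inj.
- by move=> i j ne; apply: djZ => /injg /rshift_inj.
- by move=> i j; apply: djYZ; apply: neg.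
Qed.

End Walks.

Arguments walk {D}.

(** * Reversal of all arcs *)

Definition op (D : digraph) : digraph :=
  @Digraph (vertices D) (arcs D) (@arc_head D) (@arc_tail D)
    (fun a => introT negP (fun h => negP (loopless a) (etrans (eq_sym _ _) h))).

Lemma walk_op (D : digraph) (x y : vertices D) p :
  walk (D := op D) y x (rev p) = walk x y p.
Proof.
elim: p x => [|a p IH] x; first exact: eq_sym.
rewrite rev_cons -cats1 /=; apply/idP/andP => [h|[/eqP ax wp]].
  have [w _] := walk_tail (D := op D) h; have [_ /eqP ex] := walk_head (D := op D) h.
  by rewrite -IH; split=> //; apply/eqP.
apply: (walk_cat (D := op D) (y := @arc_head D a)).
  by move: wp; rewrite -IH.
by apply/andP; split; apply/eqP.
Qed.

Lemma is_path_op (D : digraph) (x y : vertices D) p :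
  is_path (D := op D) x y p -> is_path y x (rev p).
Proof.
move=> pp; have wp := is_path_walk pp.
have up : uniq (rev p) by rewrite rev_uniq; case: p pp {wp} => //= a p /and4P[].
have nil_p : rev p != [::] by case: (p) pp => // a q _; rewrite rev_cons -size_eq0 size_rcons.
have : walk y x (rev p) by rewrite -walk_op revK.
case: (rev p) up nil_p => // a q /= -> _ /andP[-> wq]; rewrite /=.
elim: q a wq => [|b q IH] a /= => [->//|/andP[/eqP e /IH/andP[-> ->]]].
by rewrite e eqxx.
Qed.

(** The onion star is isomorphic to its own reversal, with each [y_i] and [z_i] exchanged. *)
Lemma immersed_op t (D : digraph) :
  immersed (onion_star t) (op D) -> immersed (onion_star t) D.
Proof.
case=> f [p [injf pathp djp]].
pose sv (u : onion_vertex t) : onion_vertex t := match u with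
  | Some (inl i) => Some (inr i) | Some (inr i) => Some (inl i) | None => None end.
pose sa (a : onion_arc t) : onion_arc t := match a with
  | inl (inl i) => inl (inr i) | inl (inr i) => inl (inl i)
  | inr (inl ib) => inr (inr ib) | inr (inr ib) => inr (inl ib) end.
have svK : involutive sv by case=> [[]|].
have saK : involutive sa by case=> [[]|[]].
exists (f \o sv), (fun a => rev (p (sa a))); split.
- exact: inj_comp injf (inv_inj svK).
- by move=> a; have := is_path_op (pathp (sa a)); case: a => [[i|i]|[[i b]|[i b]]].
- move=> a b ne c; rewrite !mem_rev; apply: djp => /(inv_inj saK); exact: ne.
Qed.

(** * Hubs *)

Definition incident (D : digraph) (v : vertices D) (f : arcs D) :=
  (arc_tail f == v) || (arc_head f == v).

(* [pre k] and [suf k] are the part of P (g k) before [w k] and the part of Q (h k)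
   after it. As they may meet for equal indices, a hub is used by taking the P's from
   one half of the indices and the Q's from the other half, see [hub_split]. *)
Definition hub_points (D : digraph) (x : vertices D) (I J : Type)
    (P : I -> seq (arcs D)) (Q : J -> seq (arcs D)) n (w : 'I_n -> vertices D) :=
  exists (g : 'I_n -> I) (h : 'I_n -> J) (pre suf : 'I_n -> seq (arcs D)) (f : 'I_n -> arcs D),
  [/\ injective g, injective h,
      forall k, [/\ prefix (pre k) (P (g k)), suffix (suf k) (Q (h k)),
        walk x (w k) (pre k) & walk (w k) x (suf k)],
      forall k, [/\ f k \in P (g k), f k \in Q (h k) & incident (w k) (f k)] &
      forall k l, k <> l -> dj (pre k) (suf l)].

Definition hub (D : digraph) (x : vertices D) (I J : Type)
    (P : I -> seq (arcs D)) (Q : J -> seq (arcs D)) n :=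
  exists v, hub_points x P Q (fun _ : 'I_n => v).

(** Two nested uses of [pigeon], on the y-leaves and then on the z-leaves, that end with the
    [3 * (t + t)] indices of [immersed_thin]. The successors make the inequalities of [pigeon]
    strict. *)
Definition leaf_bound t h := ((3 * (t + t) * h).+1 * h).+1.

Section Hubs.

Variables (D : digraph) (x : vertices D).
Implicit Types (a e f : arcs D) (s : seq (arcs D)).

Lemma hub_points_sub (I J : Type) (P : I -> seq (arcs D)) (Q : J -> seq (arcs D))
    n m (w : 'I_n -> vertices D) (w' : 'I_m -> vertices D) (r : 'I_m -> 'I_n) :
  injective r -> (forall k, w (r k) = w' k) -> hub_points x P Q w -> hub_points x P Q w'.
Proof.
move=> injr rw [g [h [pre [suf [f [injg injh H1 H2 H3]]]]]].
exists (g \o r), (h \o r), (pre \o r), (suf \o r), (f \o r); split.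
- exact: inj_comp.
- exact: inj_comp.
- by move=> k; rewrite -rw; apply: H1.
- by move=> k; rewrite -rw; apply: H2.
- by move=> k l ne; apply: H3 => /injr.
Qed.

Lemma leaf_or_hub t h (I J : Type)
    (P : I -> seq (arcs D)) (Q : J -> seq (arcs D)) n (y z : 'I_n -> vertices D)
    (Y Z : 'I_n -> seq (arcs D)) :
  leaf_bound t h <= n -> (forall i, x \notin heads (P i)) -> (forall j, x \notin tails (Q j)) ->
  hub_points x P Q y -> hub_points x P Q z ->
  (forall i, yleaf x (y i) (Y i)) -> (forall i, zleaf x (z i) (Z i)) ->
  (forall i j, i <> j -> [/\ dj (Y i) (Y j), dj (Z i) (Z j) & dj (Y i) (Z j)]) ->
  immersed (onion_star t) D \/ hub x P Q h.
Proof.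
move=> le_n xP xQ hy hz ly lz djYZ.
(* The arc at the hub lies on a P and on a Q: its head avoids [x] because of P, its tail because of
   Q. *)
have ne_x m (w : 'I_m -> vertices D) : hub_points x P Q w -> forall i, x != w i.
  case=> g [k [_ [_ [f [_ _ _ + _]]]]] => H2 i; have [fP fQ /orP[]/eqP <-] := H2 i.
    by apply: contraNneq (xQ (k i)) => ->; apply: map_f.
  by apply: contraNneq (xP (g i)) => ->; apply: map_f.
have [|[g injg]|[g injg [v gv]]] := @pigeon 'I_n _ y (3 * (t + t) * h).+1 h.
- by rewrite card_ord.
- have [|[g' injg']|[g' injg' [v gv]]] := @pigeon _ _ (z \o g) (3 * (t + t)) h.
  + by rewrite card_ord.
  + left; have inj k l : g (g' k) = g (g' l) -> k = l by move=> e; apply: injg'; rewrite /= e.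
    apply: (@immersed_thin D t _ x (y \o (g \o g')) (z \o (g \o g')) (Y \o (g \o g')) (Z \o (g \o g'))) => //=.
    * by move=> k l /injg e; apply: inj; rewrite e.
    * by move=> i; apply: ne_x.
    * by move=> i; apply: ne_x.
    * by move=> i j ne; case: (djYZ (g (g' i)) (g (g' j))) => // /inj.
    * by move=> i j ne; case: (djYZ (g (g' i)) (g (g' j))) => // /inj.
    * by move=> i j ne; case: (djYZ (g (g' i)) (g (g' j))) => // /inj.
  + right; exists v; apply: (hub_points_sub (w := z) (r := g \o g')) => //.
    by move=> k l /= e; apply/injg'/injg; rewrite /= e.
- by right; exists v; apply: (hub_points_sub (w := y) (r := g)).
Qed.

Lemma rcons_split a f (s s1 s2 : seq (arcs D)) :
  s ++ [:: a] = s1 ++ f :: s2 -> {subset s1 <= s} /\ {subset s2 <= s ++ [:: a]}.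
Proof.
move=> e; split=> [b|b hb]; last by rewrite e mem_cat inE hb !orbT.
case/lastP: s2 e => [|s2 d].
  by rewrite cats1 cats1 => /rcons_inj[->].
rewrite cats1 -rcons_cons -rcons_cat => /rcons_inj[-> _] h.
by rewrite mem_cat h.
Qed.

End Hubs.

Ltac submem := let a := fresh "a" in move=> a; rewrite ?(mem_cat, inE) //;
  repeat (let h := fresh in move=> /orP[h|]; first by rewrite ?h ?orbT);
  let h := fresh in move=> h; rewrite ?h ?orbT //.

(** * Where a path leaves a closed walk at x, or joins it *)

Section Points.

Variables (D : digraph) (x : vertices D) (I J : Type).
Variables (P : I -> seq (arcs D)) (Q : J -> seq (arcs D)).
Hypotheses (xP : forall i, x \notin heads (P i)) (xQ : forall j, x \notin tails (Q j)).
Hypotheses (wP : forall i, exists z, walk x z (P i)) (wQ : forall j, exists z, walk z x (Q j)).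
Hypotheses (uP : forall i, uniq (P i)) (uQ : forall j, uniq (Q j)).

(** [f] is the last arc of [e :: s] on the closed walk [p ++ e :: q']. As [P i] repeats no arc, [f]
    is not in [p], so it lies on [e :: q']. Hence the head of [f] splits both [P i] and [Q j], and
    [pq] consists of [P i] up to it and [Q j] from it. *)
Lemma zpoint i j p e s r r' q' : P i = p ++ (e :: s) ++ r -> Q j = r' ++ e :: q' ->
  exists f s1 s2 w1 w2,
  [/\ e :: s = s1 ++ f :: s2, p ++ e :: q' = w1 ++ f :: w2, dj s2 (p ++ e :: q'),
      walk x (arc_head f) (w1 ++ [:: f]) /\ walk (arc_head f) x w2 &
      exists2 pq : seq (arcs D) * seq (arcs D),
       [/\ prefix pq.1 (P i), suffix pq.2 (Q j), walk x (arc_head f) pq.1 & walk (arc_head f) x pq.2]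
       & [/\ f \in P i, f \in Q j, {subset pq.1 <= p ++ e :: s} & {subset pq.2 <= q'}]].
Proof.
move=> eP eQ; have [zP wPi] := wP i; have [zQ wQj] := wQ j.
have wW : walk x x (p ++ e :: q').
  apply: (@walk_cat _ _ (arc_tail e)).
    by move: wPi; rewrite eP /= => /walk_tail[].
  by move: wQj; rewrite eQ => /walk_tail[].
have [|s1 [f [s2 [es fW nh]]]] := @last_split _ (mem (p ++ e :: q')) (e :: s).
  by rewrite /= mem_cat mem_head orbT.
have djs : dj s2 (p ++ e :: q') by apply/hitsPn.
have [w1 [w2 eW]] := mem_split fW.
have [wa wb] : walk x (arc_head f) (w1 ++ [:: f]) /\ walk (arc_head f) x w2.
  by move: wW; rewrite eW => /walk_head.
have fP : f \in P i by rewrite eP es !mem_cat mem_head !orbT.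
have fq : f \in e :: q'.
  move: fW; rewrite /= mem_cat => /orP[fp|//].
  have := uP i; rewrite eP catA => /uniq_catP[/uniq_catP[_ _ /(_ f fp)]].
  by rewrite es mem_cat mem_head orbT => /(_ isT).
have [t1 [t2 eq]] := mem_split fq.
exists f, s1, s2, w1, w2; split=> //.
exists (p ++ s1 ++ [:: f], t2); split=> /=.
- by apply/prefixP; exists (s2 ++ r); rewrite eP es -!catA.
- by apply/suffixP; exists (r' ++ t1 ++ [:: f]); rewrite eQ eq -!catA.
- move: wPi; rewrite eP es -catA /= catA => /walk_head[+ _].
  by rewrite -catA.
- by move: wQj; rewrite eQ eq catA => /walk_head[].
- exact: fP.
- by rewrite eQ mem_cat fq orbT.
- rewrite es; submem.
- case: t1 eq => [[_ ->] //|b t1 [_ ->]]; submem.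
Qed.

(** The mirror image of [zpoint]: [f] is the first arc of [s ++ [:: e]] on the closed walk, and as
    [Q j] repeats no arc, [f] lies on [p ++ [:: e]]. *)
Lemma ypoint i j p e s r r' q' : P i = p ++ e :: r -> Q j = r' ++ s ++ e :: q' ->
  exists f s1 s2 w1 w2,
  [/\ s ++ [:: e] = s1 ++ f :: s2, p ++ e :: q' = w1 ++ f :: w2, dj s1 (p ++ e :: q'),
      walk x (arc_tail f) w1 /\ walk (arc_tail f) x (f :: w2) &
      exists2 pq : seq (arcs D) * seq (arcs D),
       [/\ prefix pq.1 (P i), suffix pq.2 (Q j), walk x (arc_tail f) pq.1 & walk (arc_tail f) x pq.2]
       & [/\ f \in P i, f \in Q j, {subset pq.1 <= p} & {subset pq.2 <= s ++ e :: q'}]].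
Proof.
move=> eP eQ; have [zP wPi] := wP i; have [zQ wQj] := wQ j.
have wW : walk x x (p ++ e :: q').
  apply: (@walk_cat _ _ (arc_tail e)).
    by move: wPi; rewrite eP => /walk_tail[].
  by move: wQj; rewrite eQ catA => /walk_tail[].
have [|s1 [f [s2 [es fW nh]]]] := @first_split _ (mem (p ++ e :: q')) (s ++ [:: e]).
  by rewrite has_cat /= !mem_cat mem_head !orbT.
have djs : dj s1 (p ++ e :: q') by apply/hitsPn.
have [w1 [w2 eW]] := mem_split fW.
have [wa wb] : walk x (arc_tail f) w1 /\ walk (arc_tail f) x (f :: w2).
  by move: wW; rewrite eW => /walk_tail.
have eQ' : Q j = (r' ++ s1) ++ f :: (s2 ++ q').
  have -> : Q j = r' ++ (s ++ [:: e]) ++ q' by rewrite eQ -catA.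
  by rewrite es -!catA.
have fp : f \in p ++ [:: e].
  move: fW; rewrite /= !mem_cat !inE => /or3P[->//|->|fq]; first by rewrite orbT.
  have : uniq (r' ++ (s ++ [:: e]) ++ q') by have := uQ j; rewrite eQ -catA.
  rewrite es => /uniq_catP[_ /uniq_catP[_ _ dq] _].
  by case: (dq f) => //; rewrite mem_cat mem_head orbT.
have [t1 [t2 eqp]] := mem_split fp.
have [sub _] := rcons_split eqp.
have eP' : P i = t1 ++ f :: (t2 ++ r) by rewrite eP -cat1s catA eqp -catA.
exists f, s1, s2, w1, w2; split=> //.
exists (t1, f :: s2 ++ q'); split=> //=.
- by apply/prefixP; exists (f :: t2 ++ r).
- by apply/suffixP; exists (r' ++ s1).
- by move: wPi; rewrite eP' => /walk_tail[].
- by move: wQj; rewrite eQ' => /walk_tail[].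
- by rewrite eP' mem_cat mem_head orbT.
- by rewrite eQ' mem_cat mem_head orbT.
- by rewrite -[e :: q']cat1s catA es; submem.
Qed.

End Points.

(* The z-leaf is where P (g k) finally leaves [W k] before [c k], on its way to [W' k];
   the y-leaf is where the extra path [m k ++ s k] from x first meets [W' k]. *)
Section FinishA.

Variables (D : digraph) (x : vertices D) (I J : Type).
Variables (P : I -> seq (arcs D)) (Q : J -> seq (arcs D)).
Hypotheses (xP : forall i, x \notin heads (P i)) (xQ : forall j, x \notin tails (Q j)).
Hypotheses (wP : forall i, exists z, walk x z (P i)) (wQ : forall j, exists z, walk z x (Q j)).
Hypotheses (uP : forall i, uniq (P i)) (uQ : forall j, uniq (Q j)).

Variables (n : nat) (g : 'I_n -> I) (h1 h2 : 'I_n -> J) (e c : 'I_n -> arcs D).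
Variables (p a q' b' r r1 r2 m s : 'I_n -> seq (arcs D)).
Hypotheses (injg : injective g) (injh1 : injective h1) (injh2 : injective h2).
Hypotheses (eP : forall k, P (g k) = p k ++ (e k :: a k) ++ c k :: r k).
Hypotheses (eQ1 : forall k, Q (h1 k) = r1 k ++ e k :: q' k).
Hypotheses (eQ2 : forall k, Q (h2 k) = r2 k ++ s k ++ c k :: b' k).

Let W k := p k ++ e k :: q' k.
Let W' k := (p k ++ e k :: a k) ++ c k :: b' k.

Hypotheses (wM : forall k, walk x (arc_tail (c k)) (m k ++ s k)).
Hypotheses (uW : forall k, uniq (W k)) (uW' : forall k, uniq (W' k)).
Hypotheses (cW : forall k, dj (c k :: b' k) (W k)) (mW' : forall k, dj (m k) (W' k)).
Hypothesis dW : forall k l, k <> l ->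
  [/\ dj (W k) (W l), dj (W k) (W' l) & dj (W' k) (W' l)].
Hypothesis dM : forall k l, k <> l ->
  [/\ dj (m k ++ s k) (W l), dj (m k ++ s k) (W' l) & dj (m k ++ s k) (m l ++ s l)].

Lemma finish_a t h : leaf_bound t h <= n -> immersed (onion_star t) D \/ hub x P Q h.
Proof.
move=> le_n.
have /choice[z zP] k : exists z : arcs D * (seq (arcs D) * seq (arcs D)),
    [/\ zleaf x (arc_head z.1) (W k ++ W' k),
     [/\ prefix z.2.1 (P (g k)), suffix z.2.2 (Q (h1 k)), walk x (arc_head z.1) z.2.1 &
        walk (arc_head z.1) x z.2.2]
     & [/\ z.1 \in P (g k), z.1 \in Q (h1 k), {subset z.2.1 <= W' k} & {subset z.2.2 <= W k}]].
  have [f [s1 [s2 [w1 [w2 [es eW djs [wa wb] [pq hpq [fP fQ sub1 sub2]]]]]]]] :=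
    zpoint wP wQ uP (eP k) (eQ1 k).
  exists (f, pq); split=> //=; last first.
    split=> // d.
      by move/sub1; rewrite /W' !mem_cat => ->.
    by move/sub2; rewrite /W !mem_cat inE => ->; rewrite !orbT.
  (* Back to x along the rest of [W k], or along the rest of [W' k], which has left [W k] for good;
     from x along [W k]. *)
  exists w2, (s2 ++ c k :: b' k), (w1 ++ [:: f]); split=> //.
  - apply: (@walk_cat _ _ (arc_tail (c k))).
      have [zz] := wP (g k); rewrite eP es -catA catA => /= /walk_head[_].
      by case/walk_tail.
    by have [zz] := wQ (h2 k); rewrite eQ2 catA => /walk_tail[].
  - rewrite /W /W' eW -[p k ++ e k :: a k]/(p k ++ (e k :: a k)) es.
    by split; [|split]; submem.
  - have := uW k; rewrite /W eW -cat1s catA => /uniq_catP[_ _ d12].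
    split; [|split]; last first.
    + apply/dj_catl; split; [apply: (dj_sub _ _ djs)|apply: (dj_sub _ _ (@cW k))] => //.
      * by rewrite eW; submem.
      * by rewrite /W eW; submem.
    + exact: dj_sym.
    + apply/dj_sym/dj_catl; split; [apply: (dj_sub _ _ djs)|apply: (dj_sub _ _ (@cW k))] => //.
      * by rewrite eW; submem.
      * by rewrite /W eW; submem.
have /choice[y yP] k : exists y : arcs D * (seq (arcs D) * seq (arcs D)),
    [/\ yleaf x (arc_tail y.1) (W' k ++ (m k ++ s k)),
     [/\ prefix y.2.1 (P (g k)), suffix y.2.2 (Q (h2 k)), walk x (arc_tail y.1) y.2.1 &
        walk (arc_tail y.1) x y.2.2]
     & [/\ y.1 \in P (g k), y.1 \in Q (h2 k), {subset y.2.1 <= W' k}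
        & {subset y.2.2 <= (m k ++ s k) ++ W' k}]].
  have eP' : P (g k) = (p k ++ e k :: a k) ++ c k :: r k by rewrite eP catA.
  have [f [s1 [s2 [w1 [w2 [es eW djs [wa wb] [pq hpq [fP fQ sub1 sub2]]]]]]]] :=
    ypoint wP wQ uQ eP' (eQ2 k).
  exists (f, pq); split=> //=; last first.
    split=> // d.
      by move/sub1 => hd; rewrite /W' mem_cat hd.
    by move/sub2; rewrite /W' !mem_cat !inE; case/or3P=> ->; rewrite ?orbT.
  (* From x along [W' k], or along the extra path until it meets [W' k]; back along the rest of
     [W' k]. *)
  exists w1, (m k ++ s1), (f :: w2); split=> //.
  - have : walk x (arc_head (c k)) ((m k ++ s k) ++ [:: c k]).
      by apply: walk_cat (wM k) _; rewrite /= !eqxx.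
    by rewrite -catA es catA => /walk_tail[].
  - have sub : {subset s1 <= s k} by case: (rcons_split es).
    split; [|split] => d; rewrite /W' ?eW !mem_cat.
    + by move=> ->.
    + by case/orP=> [->|/sub->]; rewrite !orbT.
    + by move=> ->; rewrite orbT.
  - have := uW' k; rewrite /W' eW => /uniq_catP[_ _ d12].
    have d1 : dj (m k ++ s1) (w1 ++ f :: w2).
      by apply/dj_catl; split; [have := @mW' k; rewrite /W' eW|rewrite -eW].
    by move/dj_catr: d1 => [d1 d2]; split=> //; apply: dj_sym.
apply: (@leaf_or_hub _ _ _ _ _ _ P Q n (fun k => arc_tail (y k).1) (fun k => arc_head (z k).1)
  (fun k => W' k ++ (m k ++ s k)) (fun k => W k ++ W' k)) => //.
- exists g, h2, (fun k => (y k).2.1), (fun k => (y k).2.2), (fun k => (y k).1); split=> //.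
  + by move=> k; case: (yP k).
  + by move=> k; case: (yP k) => _ _ [? ? _ _]; split=> //; rewrite /incident eqxx.
  + move=> k l ne; have [_ _ [_ _ sub1 _]] := yP k; have [_ _ [_ _ _ sub2]] := yP l.
    apply: (dj_sub sub1 sub2); apply/dj_catr.
    have [_ _ d1] := dW ne; have [_ d2 _] := dM (not_eq_sym ne).
    by split=> //; apply: dj_sym.
- exists g, h1, (fun k => (z k).2.1), (fun k => (z k).2.2), (fun k => (z k).1); split=> //.
  + by move=> k; case: (zP k).
  + by move=> k; case: (zP k) => _ _ [? ? _ _]; split=> //; rewrite /incident eqxx orbT.
  + move=> k l ne; have [_ _ [_ _ sub1 _]] := zP k; have [_ _ [_ _ _ sub2]] := zP l.
    apply: (dj_sub sub1 sub2).
    by have [_ d1 _] := dW (not_eq_sym ne); apply: dj_sym.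
- by move=> k; case: (yP k).
- by move=> k; case: (zP k).
- move=> k l ne; have [WW WW' W'W'] := dW ne; have [MW MW' MM] := dM ne.
  have [_ WW't _] := dW (not_eq_sym ne); have [MWt MW't _] := dM (not_eq_sym ne).
  split; apply/dj_catl; split; apply/dj_catr; split=> //; exact: dj_sym.
Qed.

End FinishA.

(* P (g1 k) leaves [W1 k], switches at [c k] to Q (h2 k) and arrives on [W2 k]: the
   link starts in a z-leaf and ends in a y-leaf. *)
Section FinishC.

Variables (D : digraph) (x : vertices D) (I J : Type).
Variables (P : I -> seq (arcs D)) (Q : J -> seq (arcs D)).
Hypotheses (xP : forall i, x \notin heads (P i)) (xQ : forall j, x \notin tails (Q j)).
Hypotheses (wP : forall i, exists z, walk x z (P i)) (wQ : forall j, exists z, walk z x (Q j)).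
Hypotheses (uP : forall i, uniq (P i)) (uQ : forall j, uniq (Q j)).

Variables (n : nat) (g1 g2 : 'I_n -> I) (h1 h2 : 'I_n -> J) (e1 e2 c : 'I_n -> arcs D).
Variables (p1 p2 a b' q1 q2 r1 r2 r3 r4 : 'I_n -> seq (arcs D)).
Hypotheses (injg1 : injective g1) (injg2 : injective g2).
Hypotheses (injh1 : injective h1) (injh2 : injective h2).
Hypotheses (eP1 : forall k, P (g1 k) = p1 k ++ (e1 k :: a k) ++ c k :: r1 k).
Hypotheses (eQ1 : forall k, Q (h1 k) = r2 k ++ e1 k :: q1 k).
Hypotheses (eP2 : forall k, P (g2 k) = p2 k ++ e2 k :: r3 k).
Hypotheses (eQ2 : forall k, Q (h2 k) = r4 k ++ c k :: b' k ++ e2 k :: q2 k).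

Let W1 k := p1 k ++ e1 k :: q1 k.
Let W2 k := p2 k ++ e2 k :: q2 k.
Let X k := W1 k ++ W2 k ++ a k ++ c k :: b' k.

Hypotheses (uW1 : forall k, uniq (W1 k)) (uW2 : forall k, uniq (W2 k)).
Hypotheses (dW : forall k, dj (W1 k) (W2 k)).
Hypotheses (cW1 : forall k, dj (c k :: b' k) (W1 k)).
Hypotheses (aW2 : forall k, dj (a k ++ [:: c k]) (W2 k)).
Hypothesis dX : forall k l, k <> l -> dj (X k) (X l).

Lemma finish_c t h : leaf_bound t h <= n -> immersed (onion_star t) D \/ hub x P Q h.
Proof.
move=> le_n.
have /choice[z zP] k : exists z : arcs D * arcs D * ((seq (arcs D) * seq (arcs D)) * (seq (arcs D) * seq (arcs D))),
    [/\ zleaf x (arc_head z.1.1) (X k), yleaf x (arc_tail z.1.2) (X k),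
     [/\ prefix z.2.1.1 (P (g1 k)), suffix z.2.1.2 (Q (h1 k)), walk x (arc_head z.1.1) z.2.1.1 &
        walk (arc_head z.1.1) x z.2.1.2] /\
     [/\ z.1.1 \in P (g1 k), z.1.1 \in Q (h1 k), {subset z.2.1.1 <= X k} & {subset z.2.1.2 <= X k}]
     & [/\ prefix z.2.2.1 (P (g2 k)), suffix z.2.2.2 (Q (h2 k)), walk x (arc_tail z.1.2) z.2.2.1 &
        walk (arc_tail z.1.2) x z.2.2.2] /\
      [/\ z.1.2 \in P (g2 k), z.1.2 \in Q (h2 k), {subset z.2.2.1 <= X k} & {subset z.2.2.2 <= X k}]].
  have [f [s1 [s2 [w1 [w2 [es eW djs [wa wb] [pq hpq [fP fQ sub1 sub2]]]]]]]] :=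
    zpoint wP wQ uP (eP1 k) (eQ1 k).
  have eQ2' : Q (h2 k) = (r4 k ++ [:: c k]) ++ b' k ++ e2 k :: q2 k by rewrite eQ2 -catA.
  have [f' [s1' [s2' [w1' [w2' [es' eW' djs' [wa' wb'] [pq' hpq' [fP' fQ' sub1' sub2']]]]]]]] :=
    ypoint wP wQ uQ (eP2 k) eQ2'.
  have [sub_s1' _] := rcons_split es'.
  have sub_s2 : {subset s2 <= a k}.
    by case: (s1) es => [[_ ->] //|d s [_ ->]]; submem.
  (* The link itself. It serves both leaves: continued along [W2 k] it is the second way to x from
     the z-leaf, and preceded by the start of [W1 k] the second way from x to the y-leaf. *)
  have wL : walk (arc_head f) (arc_tail f') (s2 ++ c k :: s1').
    apply: (@walk_cat _ _ (arc_tail (c k))).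
      have [zz] := wP (g1 k); rewrite eP1 es -catA catA => /= /walk_head[_].
      by case/walk_tail.
    have [zz] := wQ (h2 k).
    have -> : Q (h2 k) = r4 k ++ (c k :: s1') ++ f' :: (s2' ++ q2 k).
      rewrite eQ2; congr (_ ++ _ :: _).
      by rewrite -cat1s catA es' -catA.
    by case/walk_catP=> v wv /walk_tail[/= /andP[/eqP-> wc] _]; rewrite eqxx.
  have sX1 : {subset W1 k <= X k} by move=> d; rewrite /X !mem_cat => ->.
  have sX2 : {subset W2 k <= X k} by move=> d; rewrite /X !mem_cat => ->; rewrite orbT.
  have sX3 : {subset a k ++ c k :: b' k <= X k} by rewrite /X; submem.
  have sW1 : {subset w1 ++ [:: f] <= W1 k} by rewrite /W1 eW; submem.
  have sW2 : {subset w2 <= W1 k} by rewrite /W1 eW; submem.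
  have sW1' : {subset w1' <= W2 k} by rewrite /W2 eW'; submem.
  have sW2' : {subset f' :: w2' <= W2 k} by rewrite /W2 eW'; submem.
  have sL : {subset s2 ++ c k :: s1' <= X k}.
    move=> d; rewrite mem_cat inE => hd; apply: sX3; rewrite mem_cat inE.
    by case/or3P: hd => [/sub_s2->|->|/sub_s1'->] //; rewrite !orbT.
  have dL1 : dj (s2 ++ c k :: s1') (W1 k).
    apply/dj_catl; split=> //; apply: (dj_sub _ _ (@cW1 k)) => // d.
    by rewrite !inE => /orP[->//|/sub_s1' hd]; rewrite hd orbT.
  have dL2 : dj (s2 ++ c k :: s1') (W2 k).
    rewrite -cat1s catA; apply/dj_catl; split=> //; apply: (dj_sub _ _ (@aW2 k)) => // d.
    by rewrite !mem_cat => /orP[/sub_s2->|->//]; rewrite ?orbT.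
  have dw : dj (w1 ++ [:: f]) w2.
    by have := uW1 k; rewrite /W1 eW -cat1s catA => /uniq_catP[].
  have dw' : dj w1' (f' :: w2') by have := uW2 k; rewrite /W2 eW' => /uniq_catP[].
  exists ((f, f'), (pq, pq')); split; [| |split=> //=|split=> //=].
  - exists w2, ((s2 ++ c k :: s1') ++ f' :: w2'), (w1 ++ [:: f]); split=> //=.
    + exact: walk_cat wL wb'.
    + split; first by move=> d /sW2/sX1.
      split; last by move=> d /sW1/sX1.
      by move=> d; rewrite mem_cat => /orP[/sL|/sW2'/sX2].
    + split; [|split; last first].
      * apply/dj_sym/dj_catl; split; first exact: dj_sub dL1.
        by apply: dj_sym; apply: (dj_sub sW2 sW2' (@dW k)).
      * apply/dj_catl; split; first exact: dj_sub dL1.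
        by apply: dj_sym; apply: (dj_sub sW1 sW2' (@dW k)).
      * exact: dj_sym.
  - exists w1', ((w1 ++ [:: f]) ++ (s2 ++ c k :: s1')), (f' :: w2'); split=> //=.
    + exact: walk_cat wa wL.
    + split; first by move=> d /sW1'/sX2.
      split; last by move=> d /sW2'/sX2.
      by move=> d; rewrite mem_cat => /orP[/sW1/sX1|/sL].
    + split; [|split=> //].
      * apply/dj_sym/dj_catl; split; last exact: dj_sub dL2.
        exact: (dj_sub sW1 sW1' (@dW k)).
      * apply/dj_catl; split; last exact: dj_sub dL2.
        exact: (dj_sub sW1 sW2' (@dW k)).
  - split=> // d.
    + move/sub1; rewrite /X /W1 !mem_cat !inE; case/or3P=> ->; rewrite ?orbT //.
    + by move/sub2; rewrite /X /W1 !mem_cat !inE => ->; rewrite ?orbT.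
  - split=> // d.
    + by move/sub1'; rewrite /X /W2 !mem_cat !inE => ->; rewrite ?orbT.
    + by move/sub2'; rewrite /X /W2 !mem_cat !inE; case/or3P=> ->; rewrite ?orbT.
apply: (@leaf_or_hub _ _ _ _ _ _ P Q n (fun k => arc_tail (z k).1.2) (fun k => arc_head (z k).1.1)
  X X) => //.
- exists g2, h2, (fun k => (z k).2.2.1), (fun k => (z k).2.2.2), (fun k => (z k).1.2); split=> //.
  + by move=> k; case: (zP k) => _ _ _ [].
  + by move=> k; case: (zP k) => _ _ _ [_ [? ? _ _]]; split=> //; rewrite /incident eqxx.
  + move=> k l ne; have [_ _ _ [_ [_ _ sub1 _]]] := zP k; have [_ _ _ [_ [_ _ _ sub2]]] := zP l.
    by apply: (dj_sub sub1 sub2); apply: dX.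
- exists g1, h1, (fun k => (z k).2.1.1), (fun k => (z k).2.1.2), (fun k => (z k).1.1); split=> //.
  + by move=> k; case: (zP k) => _ _ [].
  + by move=> k; case: (zP k) => _ _ [_ [? ? _ _]] _; split=> //; rewrite /incident eqxx orbT.
  + move=> k l ne; have [_ _ [_ [_ _ sub1 _]] _] := zP k; have [_ _ [_ [_ _ _ sub2]] _] := zP l.
    by apply: (dj_sub sub1 sub2); apply: dX.
- by move=> k; case: (zP k).
- by move=> k; case: (zP k).
- by move=> k l ne; split; apply: dX.
Qed.

End FinishC.

(** * Stairs *)

(** Only the ends at x are fixed: a P may stop and a Q may start anywhere, so that initial parts of
    the P's qualify again. *)
Record families (D : digraph) (x : vertices D) (I J : Type)
    (P : I -> seq (arcs D)) (Q : J -> seq (arcs D)) : Prop := Families {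
  fam_xP : forall i, x \notin heads (P i);
  fam_xQ : forall j, x \notin tails (Q j);
  fam_wP : forall i, exists z, walk x z (P i);
  fam_wQ : forall j, exists z, walk z x (Q j);
  fam_uP : forall i, uniq (P i);
  fam_uQ : forall j, uniq (Q j);
  fam_dP : forall i j a, a \in P i -> a \in P j -> i = j;
  fam_dQ : forall i j a, a \in Q i -> a \in Q j -> i = j }.

Lemma families_sub (D : digraph) (x : vertices D) (I J I' J' : Type)
    (P : I -> seq (arcs D)) (Q : J -> seq (arcs D)) (g : I' -> I) (h : J' -> J) :
  injective g -> injective h -> families x P Q -> families x (P \o g) (Q \o h).
Proof.
move=> injg injh [? ? ? ? ? ? dP dQ]; split=> //= i j a ha hb.
  by apply: injg; apply: dP ha hb.
by apply: injh; apply: dQ ha hb.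
Qed.

(* The closed walks [p i ++ e i :: q' i] at x are pairwise disjoint. *)
Record stair (D : digraph) (x : vertices D) (I : Type)
    (P Q p p' q q' : I -> seq (arcs D)) (e : I -> arcs D) : Prop := Stair {
  st_fam : families x P Q;
  st_P : forall i, P i = p i ++ e i :: p' i;
  st_Q : forall i, Q i = q i ++ e i :: q' i;
  st_pq : forall i j a, a \in p i -> a \in q' j -> False }.

Section StairFacts.

Variables (D : digraph) (x : vertices D) (I : Type).
Variables (P Q p p' q q' : I -> seq (arcs D)) (e : I -> arcs D).
Hypothesis st : stair x P Q p p' q q' e.

Lemma st_pP i d : d \in p i -> d \in P i.
Proof. by rewrite (st_P st) mem_cat => ->. Qed.
Lemma st_eP i d : d == e i -> d \in P i.
Proof. move=> /eqP->; by rewrite (st_P st) mem_cat mem_head orbT. Qed.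
Lemma st_p'P i d : d \in p' i -> d \in P i.
Proof. by rewrite (st_P st) mem_cat inE => ->; rewrite !orbT. Qed.
Lemma st_qQ i d : d \in q i -> d \in Q i.
Proof. by rewrite (st_Q st) mem_cat => ->. Qed.
Lemma st_eQ i d : d == e i -> d \in Q i.
Proof. move=> /eqP->; by rewrite (st_Q st) mem_cat mem_head orbT. Qed.
Lemma st_q'Q i d : d \in q' i -> d \in Q i.
Proof. by rewrite (st_Q st) mem_cat inE => ->; rewrite !orbT. Qed.
Lemma st_PP i j d : d \in P i -> d \in P j -> i <> j -> False.
Proof. by move=> h1 h2 ne; apply: ne; apply: (fam_dP (st_fam st)) h1 h2. Qed.
Lemma st_QQ i j d : d \in Q i -> d \in Q j -> i <> j -> False.
Proof. by move=> h1 h2 ne; apply: ne; apply: (fam_dQ (st_fam st)) h1 h2. Qed.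

Lemma st_uniqP i : [/\ uniq (p i), e i \notin p i, e i \notin p' i, uniq (p' i) & dj (p i) (p' i)].
Proof.
have := fam_uP (st_fam st) i; rewrite (st_P st) => /uniq_catP[-> /= /andP[-> ->] h].
split=> //; first by apply/negP => /h; apply; apply: mem_head.
by move=> d h1 h2; apply: (h d) => //; rewrite inE h2 orbT.
Qed.

Lemma st_uniqQ i : [/\ uniq (q i), e i \notin q i, e i \notin q' i, uniq (q' i) & dj (q i) (q' i)].
Proof.
have := fam_uQ (st_fam st) i; rewrite (st_Q st) => /uniq_catP[-> /= /andP[-> ->] h].
split=> //; first by apply/negP => /h; apply; apply: mem_head.
by move=> d h1 h2; apply: (h d) => //; rewrite inE h2 orbT.
Qed.

Lemma st_uniqW i : uniq (p i ++ e i :: q' i).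
Proof.
have [u1 ep _ _ _] := st_uniqP i; have [_ _ eq u2 _] := st_uniqQ i.
apply/uniq_catP; split=> //=; first by rewrite eq u2.
move=> d hd; rewrite inE => /orP[/eqP ed|]; first by rewrite -ed hd in ep.
exact: (st_pq st hd).
Qed.

End StairFacts.

Ltac orcases := repeat match goal with
  | |- is_true (orb _ _) -> _ => case/orP
  end.

Ltac memcases := let d := fresh "d" in move=> d; rewrite ?(mem_cat, inE);
  repeat match goal with
  | |- is_true (orb _ _) -> _ => case/orP
  end; let h := fresh "h" in move=> h;
  rewrite ?(mem_cat, inE); repeat match goal with
  | |- is_true (orb _ _) -> _ => case/orP
  end; let h' := fresh "h'" in move=> h'; move: h h'.

(* After a second matching, of the parts [a k] of P (mu k) with Q (tau k) along [c k],
   there are two systems of disjoint closed walks, [W] and [W']. *)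
Section CaseAMid.

Variables (D : digraph) (x : vertices D) (n s : nat).
Variables (P Q p p' q q' : 'I_n -> seq (arcs D)) (e : 'I_n -> arcs D).
Hypothesis st : stair x P Q p p' q q' e.
Variables (mu tau : 'I_s -> 'I_n) (a ra b b' : 'I_s -> seq (arcs D)) (c : 'I_s -> arcs D).
Hypotheses (injmu : injective mu) (injtau : injective tau).
Hypothesis mu_tau : forall k l, mu k <> tau l.
Hypotheses (ep' : forall k, p' (mu k) = a k ++ c k :: ra k).
Hypotheses (eq' : forall k, q' (tau k) = b k ++ c k :: b' k).
Hypothesis ab' : forall k l d, d \in a k -> d \in b' l -> False.
Hypothesis aq' : forall k l d, k <> l -> d \in a k -> d \in q' (mu l) -> False.

Let pp k := p (mu k) ++ e (mu k) :: a k.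
Let W k := p (mu k) ++ e (mu k) :: q' (mu k).
Let W' k := pp k ++ c k :: b' k.

Let aP k d : d \in a k -> d \in P (mu k).
Proof. by move=> h; apply: (st_p'P st); rewrite ep' mem_cat h. Qed.
Let cP k d : d == c k -> d \in P (mu k).
Proof. by move=> /eqP->; apply: (st_p'P st); rewrite ep' mem_cat mem_head orbT. Qed.
Let bq' k d : d \in b k -> d \in q' (tau k).
Proof. by rewrite eq' mem_cat => ->. Qed.
Let b'q' k d : d \in b' k -> d \in q' (tau k).
Proof. by rewrite eq' mem_cat inE => ->; rewrite !orbT. Qed.
Let cq' k d : d == c k -> d \in q' (tau k).
Proof. by move=> /eqP->; rewrite eq' mem_cat mem_head orbT. Qed.
Let nemu k l : k <> l -> mu k <> mu l. Proof. by move=> ne /injmu. Qed.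
Let netau k l : k <> l -> tau k <> tau l. Proof. by move=> ne /injtau. Qed.
Let tau_mu k l : tau k <> mu l. Proof. by move=> /esym; apply: mu_tau. Qed.
Let stpq := st_pq st.
Let PP := st_PP st.
Let QQ := st_QQ st.
Let pP := st_pP st.
Let eP := st_eP st.
Let eQ := st_eQ st.
Let q'Q := st_q'Q st.
Let bQ k d : d \in b k -> d \in Q (tau k). Proof. by move/bq'/q'Q. Qed.
Let b'Q k d : d \in b' k -> d \in Q (tau k). Proof. by move/b'q'/q'Q. Qed.
Let cQ k d : d == c k -> d \in Q (tau k). Proof. by move/cq'/q'Q. Qed.

Ltac toP h := first [exact (pP h) | exact (eP h) | exact (aP h) | exact (cP h)].
Ltac toQ h := first [exact (q'Q h) | exact (eQ h) | exact (bQ h) | exact (b'Q h) | exact (cQ h)].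
Ltac toq' h := first [exact h | exact (bq' h) | exact (b'q' h) | exact (cq' h)].
Ltac ne := first [exact: mu_tau | exact: tau_mu | apply: nemu; assumption | apply: netau; assumption
  | apply: nemu; apply: not_eq_sym; assumption | apply: netau; apply: not_eq_sym; assumption].
Ltac ne0 := first [assumption | apply: not_eq_sym; assumption].
Ltac fin1 h h' := first
  [ eapply stpq; [exact h | toq' h'] | eapply ab'; [exact h | exact h']
  | eapply aq'; [ | exact h | exact h']; ne0
  | eapply PP; [toP h | toP h' | ne] | eapply QQ; [toQ h | toQ h' | ne] ].
Ltac fin := let h := fresh in let h' := fresh in intros h h'; first [fin1 h h' | fin1 h' h].

(** Every pair of pieces is excluded by the disjointness of the P's or of the Q's, by stability of
    the first matching ([stpq]) or of the second ([ab']), or by [aq']. *)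
Lemma mid_dW k l : k <> l -> [/\ dj (W k) (W l), dj (W k) (W' l) & dj (W' k) (W' l)].
Proof. by move=> ne; split; rewrite /W /W' /pp; memcases; fin. Qed.

Lemma mid_cW k : dj (c k :: b' k) (W k).
Proof. by rewrite /W; memcases; fin. Qed.

Lemma mid_uW' k : uniq (W' k).
Proof.
have := fam_uP (st_fam st) (mu k); rewrite (st_P st) ep' -cat_cons catA => /uniq_catP[u1 _ d1].
have := fam_uQ (st_fam st) (tau k); rewrite (st_Q st) eq' -cat_cons catA => /uniq_catP[_ u2 _].
apply/uniq_catP; split=> // d hd; rewrite inE => /orP[/eqP dc|].
  by apply: (d1 d) => //; rewrite dc mem_head.
by move: hd; rewrite /pp mem_cat inE => /or3P[]; fin.
Qed.

Let wP i : exists z, walk x z (P i). Proof. exact: fam_wP (st_fam st) i. Qed.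
Let wQ i : exists z, walk z x (Q i). Proof. exact: fam_wQ (st_fam st) i. Qed.

Let eP1 k : P (mu k) = p (mu k) ++ (e (mu k) :: a k) ++ c k :: ra k.
Proof. by rewrite (st_P st) ep'. Qed.

(* Here the whole of [b] is free: the second path into the y-leaf follows P (tau k)
   up to [e (tau k)], then Q (tau k). *)
Lemma mid_complete t h m (kap : 'I_m -> 'I_s) :
  injective kap -> leaf_bound t h <= m ->
  (forall k l, k <> l -> dj (b (kap k)) (pp (kap l))) ->
  immersed (onion_star t) D \/ hub x P Q h.
Proof.
move=> injk le_m bpp.
have nek k l : k <> l -> kap k <> kap l by move=> ne /injk.
apply: (@finish_a _ _ _ _ P Q (fam_xP (st_fam st)) (fam_xQ (st_fam st)) wP wQ
  (fam_uP (st_fam st)) (fam_uQ (st_fam st)) m (mu \o kap) (mu \o kap) (tau \o kap)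
  (e \o (mu \o kap)) (c \o kap) (p \o (mu \o kap)) (a \o kap) (q' \o (mu \o kap))
  (b' \o kap) (ra \o kap) (q \o (mu \o kap)) (fun k => q (tau (kap k)) ++ [:: e (tau (kap k))])
  (fun k => p (tau (kap k)) ++ [:: e (tau (kap k))]) (b \o kap)) => //=.
- by move=> k l /injmu/injk.
- by move=> k l /injmu/injk.
- by move=> k l /injtau/injk.
- by move=> k; rewrite (st_Q st).
- by move=> k; rewrite (st_Q st) eq' -catA.
- move=> k; apply: (@walk_cat _ _ (arc_head (e (tau (kap k))))).
    by have [z] := wP (tau (kap k)); rewrite (st_P st) => /walk_head[].
  have [z] := wQ (tau (kap k)); rewrite (st_Q st) eq' => /walk_head[_].
  by case/walk_tail.
- by move=> k; apply: (st_uniqW st).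
- by move=> k; apply: mid_uW'.
- by move=> k; apply: mid_cW.
(* The pair left over by [fin] is [e (tau (kap k))] against [b' (kap k)]: both lie on the same Q,
   which repeats no arc. *)
- move=> k; have [_ _ + _ _] := st_uniqQ st (tau (kap k)); rewrite eq' mem_cat => eb.
  memcases; try fin.
  by move=> /eqP-> hb; move: eb; rewrite inE hb !orbT.
- by move=> k l ne; apply: mid_dW; apply: nek.
- move=> k l /nek ne; split; memcases; try fin.
  all: by move=> hb hp; apply: (bpp k l) hb _; [move=> kl; apply: ne; rewrite kl|
    rewrite mem_cat inE hp ?orbT].
Qed.

(* Here the second path into the y-leaf follows P (mu (sig k)) up to the arc [d k],
   where it switches to the last part [nn k] of [b]. *)
Lemma mid_exact t h m (kap sig : 'I_m -> 'I_s) (bb nn rr rr' : 'I_m -> seq (arcs D))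
    (d : 'I_m -> arcs D) :
  injective kap -> injective sig -> (forall k l, kap k <> sig l) -> leaf_bound t h <= m ->
  (forall k, b (kap k) = bb k ++ d k :: nn k) ->
  (forall k, pp (sig k) = rr k ++ d k :: rr' k) ->
  (forall k l, dj (nn k) (rr l)) ->
  (forall k l, k <> l -> dj (nn k) (pp (kap l))) ->
  immersed (onion_star t) D \/ hub x P Q h.
Proof.
move=> injk injs neks le_m eb epp dnr dnp.
have nek k l : k <> l -> kap k <> kap l by move=> ne /injk.
have nes k l : k <> l -> sig k <> sig l by move=> ne /injs.
have [nn_b d_b] : (forall k f, f \in nn k -> f \in b (kap k)) /\
    (forall k f, f == d k -> f \in b (kap k)).
  by split=> k f h0; rewrite eb mem_cat inE h0 !orbT.
have rr_pp k f : f \in rr k ++ [:: d k] -> f \in pp (sig k).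
  by rewrite epp !mem_cat !inE => /orP[]->; rewrite ?orbT.
have sig_pp k f : f \in pp (sig k) -> [\/ f \in p (mu (sig k)), f == e (mu (sig k)) | f \in a (sig k)].
  by rewrite mem_cat inE => /or3P.
have rW' k l : dj (rr k ++ [:: d k]) (W' (kap l)).
  have ne : sig k <> kap l by move=> /esym; apply: neks.
  move=> f /rr_pp/sig_pp hf; rewrite !mem_cat !inE.
  by case: hf => h0; orcases=> h1; move: h0 h1; fin.
have rW k l : dj (rr k ++ [:: d k]) (W (kap l)).
  have ne : sig k <> kap l by move=> /esym; apply: neks.
  move=> f /rr_pp/sig_pp hf; rewrite !mem_cat !inE.
  by case: hf => h0; orcases=> h1; move: h0 h1; fin.
have ppP k f : f \in pp k -> f \in P (mu k).
  by rewrite mem_cat inE => /or3P[/pP|/eP|/aP].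
apply: (@finish_a _ _ _ _ P Q (fam_xP (st_fam st)) (fam_xQ (st_fam st)) wP wQ
  (fam_uP (st_fam st)) (fam_uQ (st_fam st)) m (mu \o kap) (mu \o kap) (tau \o kap)
  (e \o (mu \o kap)) (c \o kap) (p \o (mu \o kap)) (a \o kap) (q' \o (mu \o kap))
  (b' \o kap) (ra \o kap) (q \o (mu \o kap))
  (fun k => q (tau (kap k)) ++ e (tau (kap k)) :: bb k ++ [:: d k])
  (fun k => rr k ++ [:: d k]) nn) => //=.
- by move=> k l /injmu/injk.
- by move=> k l /injmu/injk.
- by move=> k l /injtau/injk.
- by move=> k; rewrite (st_Q st).
- by move=> k; rewrite (st_Q st) eq' eb -!catA /= -!catA.
- move=> k; apply: (@walk_cat _ _ (arc_head (d k))).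
    have [z] := wP (mu (sig k)); rewrite eP1 catA -/(pp _) epp -catA => /walk_head[].
    by [].
  have [z] := wQ (tau (kap k)); rewrite (st_Q st) eq' eb => /walk_head[_].
  by rewrite -catA => /walk_head[_] /walk_tail[].
- by move=> k; apply: (st_uniqW st).
- by move=> k; apply: mid_uW'.
- by move=> k; apply: mid_cW.
- by move=> k; apply: rW'.
- by move=> k l ne; apply: mid_dW; apply: nek.
- move=> k l ne'; have ne := nek _ _ ne'; split.
  + apply/dj_catl; split; first exact: rW.
    by move=> f /nn_b h0; rewrite mem_cat inE => /or3P[h1|h1|h1]; move: h0 h1; fin.
  + apply/dj_catl; split; first exact: rW'.
    move=> f h0; rewrite mem_cat => /orP[h1|]; first exact: dnp ne' _ h0 h1.
    by move/nn_b: h0 => h0; rewrite inE => /orP[h1|h1]; move: h0 h1; fin.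
  + have nes' := nes _ _ ne'.
    apply/dj_catl; split; apply/dj_catr; split.
    * by move=> f /rr_pp/ppP h0 /rr_pp/ppP h1; apply: PP h0 h1 _; apply: nemu.
    * move=> f; rewrite mem_cat inE => /orP[h0 h1|/d_b h0 /nn_b h1]; first exact: (dnr l k f).
      by move: h0 h1; fin.
    * move=> f + ; rewrite mem_cat inE => h0 /orP[h1|/d_b h1]; first exact: (dnr k l f).
      by move/nn_b: h0 => h0; move: h0 h1; fin.
    * by move=> f /nn_b h0 /nn_b h1; move: h0 h1; fin.
Qed.

End CaseAMid.

Lemma pigeon_bool (I : finType) (f : pred I) h : 2 * h < #|I| ->
  exists2 g : 'I_h -> I, injective g & (forall k, f (g k)) \/ (forall k, ~~ f (g k)).
Proof.
move=> lt_h; have : h <= #|f| \/ h <= #|[predC f]|.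
  by have := cardC f; case: (leqP h #|f|) => ?; [left|right; lia].
case=> le_h.
  have /inj_of_card[g [injg hg]] : h <= #|[set i | f i]| by rewrite cardsE.
  by exists g => //; left=> k; have := hg k; rewrite inE.
have /inj_of_card[g [injg hg]] : h <= #|[set i | ~~ f i]| by rewrite cardsE.
by exists g => //; right=> k; have := hg k; rewrite inE.
Qed.

(** [indep] with out-degree [leaf_bound t h] must leave enough indices that [leaf_bound t h] of them
    agree on whether their [b] was cut. *)
Definition case_a_bound t h :=
  (2 * leaf_bound t h + 1) * (2 * leaf_bound t h).+1.

Section CaseA.

Variables (D : digraph) (x : vertices D) (n : nat).
Variables (P Q p p' q q' : 'I_n -> seq (arcs D)) (e : 'I_n -> arcs D).
Hypothesis st : stair x P Q p p' q q' e.

(** A matching of the [O k] with outside walks gives [W] and [W']; missing is a second path into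
    [W'], arriving along [b]. Each [b] is followed backwards until it has met enough other [pp l]:
    if it survives whole, [mid_complete] applies, and otherwise another matching finds the P on
    which to start. *)
Lemma case_a t h (g : 'I_(case_a_bound t h) -> 'I_n) (O : 'I_(case_a_bound t h) -> seq (arcs D)) :
  injective g -> (forall k, prefix (O k) (p' (g k))) ->
  (forall k l, k <> l -> dj (O k) (q' (g l))) ->
  (forall k, case_a_bound t h <= #|[set j | (j != g k) && hits (O k) (q' j)]|) ->
  immersed (onion_star t) D \/ hub x P Q h.
Proof.
set L := leaf_bound t h; rewrite /case_a_bound -/L in g O *; set s := _ * _ in g O *.
move=> injg prefO djO hitsO.
have Op' k d : d \in O k -> d \in p' (g k).
  by have /prefixP[r ->] := prefO k; rewrite mem_cat => ->.
have dPg k l d : d \in P (g k) -> d \in P (g l) -> k = l.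
  by move=> h1 h2; apply: injg; apply: (fam_dP (st_fam st)) h1 h2.
have djq' i j d : d \in q' i -> d \in q' j -> i = j.
  by move=> /(st_q'Q st) h1 /(st_q'Q st); apply: (fam_dQ (st_fam st)) h1.
have [||||k|g2 [tau [a [a' [b [b' [c [injg2 [injtau tau_g] eO eq' djab]]]]]]]] :=
    @linking_out _ _ _ O q' [set g k | k : 'I_s] s.
- by move=> k l d /Op'/(st_p'P st) h1 /Op'/(st_p'P st); apply: dPg h1.
- exact: djq'.
- by move=> j; have [] := st_uniqQ st j.
- by rewrite card_ord.
- apply: leq_trans (hitsO k) _; apply: subset_leq_card.
  apply/subsetP => j; rewrite !inE => /andP[ne hit]; rewrite hit andbT.
  apply/imsetP => -[l _ jl]; move/hitsPn: hit => []; rewrite jl.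
  by apply: djO => kl; move: ne; rewrite jl kl eqxx.
pose mu k := g (g2 k).
have injmu : injective mu by move=> k l /injg/injg2.
have mu_tau k l : mu k <> tau l.
  move=> kl; have := tau_g l; rewrite -kl => /negP; apply.
  by apply/imsetP; exists (g2 k).
have /choice[o oP] k : exists o, p' (mu k) = O (g2 k) ++ o by apply/prefixP/prefO.
have ep' k : p' (mu k) = a k ++ c k :: (a' k ++ o k) by rewrite oP eO -catA.
have aO k d : d \in a k -> d \in O (g2 k) by rewrite eO mem_cat => ->.
have aq' k l d : k <> l -> d \in a k -> d \in q' (mu l) -> False.
  by move=> ne /aO; apply: djO => /injg2.
pose pp k := p (mu k) ++ e (mu k) :: a k.
have ppP k d : d \in pp k -> d \in P (mu k).
  rewrite (st_P st) ep' !(mem_cat, inE).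
  by case/or3P=> ->; rewrite ?orbT.
have djpp k l d : d \in pp k -> d \in pp l -> k = l.
  by move=> /ppP h1 /ppP h2; apply/injmu/(fam_dP (st_fam st) h1 h2).
have /choice[bn bnP] k : exists bn : seq (arcs D) * seq (arcs D), [/\ b k = bn.1 ++ bn.2,
    #|[set l | (k != l) && hits bn.2 (pp l)]| <= L &
    bn.1 = [::] \/ #|[set l | (k != l) && hits bn.2 (pp l)]| = L].
  have [|b1 [b2 [eb le1 h2]]] := @trunc_suffix _ _ (fun l => if k == l then [::] else pp l) L (b k).
    by move=> i j d; case: ifP; case: ifP => // _ _; apply: djpp.
  have eqS : [set j | hits b2 (if k == j then [::] else pp j)] = [set l | (k != l) && hits b2 (pp l)].
    apply/setP => l; rewrite !inE; case: eqP => //= _.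
    by apply/negP => /hitsP[].
  by exists (b1, b2); rewrite -eqS.
have [|k||g3 injg3 indep3] :=
    @indep _ (fun k l => (k != l) && hits (bn k).2 (pp l)) L (2 * L).+1.
- by move=> k; rewrite eqxx.
- by have [] := bnP k.
- by rewrite card_ord.
have {}indep3 k l : g3 k <> g3 l -> dj (bn (g3 k)).2 (pp (g3 l)).
  by move=> /eqP ne; apply/hitsPn; have := indep3 k l; rewrite ne.
have [|g4 injg4 [full|part]] := @pigeon_bool 'I_(2 * L).+1 (fun k => (bn (g3 k)).1 == [::]) L.
- by rewrite card_ord.
- apply: (mid_complete st injmu injtau mu_tau ep' eq' djab aq' (kap := g3 \o g4)) => //.
    exact: inj_comp.
  move=> k l ne; have [-> _ _] := bnP (g3 (g4 k)); rewrite (eqP (full k)) /=.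
  by apply: indep3 => /injg3/injg4.
pose kap := g3 \o g4; have injkap : injective kap by apply: inj_comp.
(* The lists are reversed because here the [b] side prefers late arcs and the [pp] side early ones:
   the part of [b] after [d] then avoids the part of [pp] before [d]. *)
have [||||k|g5 [sig [a1 [a2 [b1 [b2 [d [injg5 [injsig sig_kap] eni epp djab1]]]]]]]] :=
    @linking_out _ _ _ (fun k => rev (bn (kap k)).2) (fun l => rev (pp l)) [set kap k | k : 'I_L] L.
- move=> k l d; rewrite !mem_rev => h1 h2; apply/injkap/injtau.
  have sub k0 : d \in (bn k0).2 -> d \in q' (tau k0).
    by rewrite eq'; have [-> _ _] := bnP k0; rewrite !mem_cat => ->; rewrite orbT.
  by apply: djq' (sub _ h1) (sub _ h2).
- by move=> k l d; rewrite !mem_rev; apply: djpp.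
- move=> l; rewrite rev_uniq; have := fam_uP (st_fam st) (mu l).
  by rewrite (st_P st) ep' -(cat_cons (e (mu l))) catA => /uniq_catP[].
- by rewrite card_ord.
- have [_ _ [e0|eL]] := bnP (kap k); first by have := part k; rewrite e0.
  apply: leq_trans (eq_leq (esym eL)) (subset_leq_card _); apply/subsetP => l; rewrite !inE /hits => /andP[ne].
  rewrite has_rev (eq_has (a2 := mem (pp l))); last by move=> f /=; rewrite mem_rev.
  move=> hit; rewrite hit andbT.
  apply/imsetP => -[l' _ ll']; move/hitsPn: hit => []; rewrite ll'.
  by apply: indep3 => /eqP; rewrite -[_ == _]/(kap k == kap l') -ll' (negPf ne).
apply: (mid_exact st injmu injtau mu_tau ep' eq' djab aq' (kap := kap \o g5) (sig := sig)
  (bb := fun k => (bn (kap (g5 k))).1 ++ rev (a2 k)) (nn := fun k => rev (a1 k))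
  (rr := fun k => rev (b2 k)) (rr' := fun k => rev (b1 k)) (d := d)) => //=.
- exact: inj_comp.
- move=> k l kl; have := sig_kap l; rewrite -kl => /negP; apply.
  by apply/imsetP; exists (g5 k).
- move=> k; have [-> _ _] := bnP (kap (g5 k)).
  by rewrite -[(bn _).2]revK eni rev_cat rev_cons -cats1 -!catA.
- by move=> k; rewrite -[LHS]revK epp rev_cat rev_cons -cats1 -catA.
- by move=> k l; apply/dj_revl/dj_revr.
- move=> k l ne; apply/dj_revl => f hf; apply: (indep3 (g4 (g5 k)) (g4 (g5 l))).
    by move=> /injg3/injg4/injg5.
  by rewrite -mem_rev -[rev _]/(rev (bn (kap (g5 k))).2) eni mem_cat hf.
Qed.

End CaseA.

Section CaseC.

Variables (D : digraph) (x : vertices D) (n : nat).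
Variables (P Q p p' q q' : 'I_n -> seq (arcs D)) (e : 'I_n -> arcs D).
Hypothesis st : stair x P Q p p' q q' e.
Hypothesis p'q' : forall k l d, d \in p' k -> d \in q' l -> k <> l -> False.
Hypothesis qp : forall k l d, d \in q k -> d \in p l -> k <> l -> False.

Let stpq := st_pq st.
Let PP := st_PP st.
Let QQ := st_QQ st.
Let pP := st_pP st.
Let eP := st_eP st.
Let p'P := st_p'P st.
Let eQ := st_eQ st.
Let qQ := st_qQ st.
Let q'Q := st_q'Q st.

Section Linked.

Variables (m : nat) (X Y : 'I_m -> 'I_n) (a a' b b' : 'I_m -> seq (arcs D)) (c : 'I_m -> arcs D).
Hypotheses (injX : injective X) (injY : injective Y) (XY : forall k l, X k <> Y l).
Hypotheses (ea : forall k, p' (X k) = a k ++ c k :: a' k).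
Hypotheses (eb : forall k, q (Y k) = b k ++ c k :: b' k).
Hypothesis ab' : forall k l d, d \in a k -> d \in b' l -> False.

Let YX k l : Y k <> X l. Proof. by move=> /esym; apply: XY. Qed.
Let neX k l : k <> l -> X k <> X l. Proof. by move=> ne /injX. Qed.
Let neY k l : k <> l -> Y k <> Y l. Proof. by move=> ne /injY. Qed.
Let ap' k d : d \in a k -> d \in p' (X k). Proof. by rewrite ea mem_cat => ->. Qed.
Let cp' k d : d == c k -> d \in p' (X k).
Proof. by rewrite ea mem_cat inE => ->; rewrite orbT. Qed.
Let cq k d : d == c k -> d \in q (Y k).
Proof. by rewrite eb mem_cat inE => ->; rewrite orbT. Qed.
Let b'q k d : d \in b' k -> d \in q (Y k).
Proof. by rewrite eb mem_cat inE => ->; rewrite !orbT. Qed.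
Let aP k d : d \in a k -> d \in P (X k). Proof. by move/ap'/p'P. Qed.
Let cP k d : d == c k -> d \in P (X k). Proof. by move/cp'/p'P. Qed.
Let cQ k d : d == c k -> d \in Q (Y k). Proof. by move/cq/qQ. Qed.
Let b'Q k d : d \in b' k -> d \in Q (Y k). Proof. by move/b'q/qQ. Qed.

Ltac toP h := first [exact (pP h) | exact (eP h) | exact (aP h) | exact (cP h)].
Ltac toQ h := first [exact (q'Q h) | exact (eQ h) | exact (b'Q h) | exact (cQ h)].
Ltac top' h := first [exact (ap' h) | exact (cp' h)].
Ltac toq h := first [exact (b'q h) | exact (cq h)].
Ltac ne := first [exact: XY | exact: YX | apply: neX; assumption | apply: neY; assumption
  | apply: neX; apply: not_eq_sym; assumption | apply: neY; apply: not_eq_sym; assumption].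
Ltac fin1 h h' := first
  [ eapply stpq; [exact h | exact h'] | eapply ab'; [exact h | exact h']
  | eapply p'q'; [top' h | exact h' | ne] | eapply qp; [toq h | exact h' | ne]
  | eapply PP; [toP h | toP h' | ne] | eapply QQ; [toQ h | toQ h' | ne] ].
Ltac fin := let h := fresh in let h' := fresh in intros h h'; first [fin1 h h' | fin1 h' h].

Lemma case_c_linked t h : leaf_bound t h <= m -> immersed (onion_star t) D \/ hub x P Q h.
Proof.
move=> le_m.
apply: (@finish_c _ _ _ _ P Q (fam_xP (st_fam st)) (fam_xQ (st_fam st)) (fam_wP (st_fam st))
  (fam_wQ (st_fam st)) (fam_uP (st_fam st)) (fam_uQ (st_fam st)) m X Y X Y (e \o X) (e \o Y) c
  (p \o X) (p \o Y) a b' (q' \o X) (q' \o Y) a' (q \o X) (p' \o Y) b) => //=.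
- by move=> k; rewrite (st_P st) ea.
- by move=> k; rewrite (st_Q st).
- by move=> k; rewrite (st_P st).
- by move=> k; rewrite (st_Q st) eb -catA.
- by move=> k; apply: (st_uniqW st).
- by move=> k; apply: (st_uniqW st).
- by move=> k; memcases; fin.
- by move=> k; memcases; fin.
- by move=> k; memcases; fin.
- by move=> k l kl; memcases; fin.
Qed.

End Linked.

(** P-indices come from one half and Q-indices from the other, so they are always distinct and only
    [p'] can still meet [q]. Many such meetings give links for [finish_c]; few give disjoint
    paths. *)
Lemma case_c t h m s : n = s + s -> leaf_bound t h + m <= s -> m * leaf_bound t h + m <= s ->
  [\/ immersed (onion_star t) D,
      exists (g g' : 'I_m -> 'I_n), [/\ injective g, injective g' &
        forall k l, dj (P (g k)) (Q (g' l))] |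
      hub x P Q h].
Proof.
move=> en le1 le2.
pose lft (k : 'I_s) := cast_ord (esym en) (lshift s k).
pose rgt (k : 'I_s) := cast_ord (esym en) (rshift s k).
have lr k l : lft k <> rgt l by move/cast_ord_inj/eqP; rewrite eq_lrshift.
have injl : injective lft by move=> k l /cast_ord_inj/lshift_inj.
have injr : injective rgt by move=> k l /cast_ord_inj/rshift_inj.
have [||[g0 injg0 hitsg]|[g [g' [injg injg' poor]]]] :=
  @rich_or_poor 'I_s 'I_s (fun k l => hits (p' (lft k)) (q (rgt l))) (leaf_bound t h) m.
- by rewrite card_ord.
- by rewrite card_ord.
- have [||||g1 [g2 [a [a' [b [b' [c [injg1 injg2 ea eb djab]]]]]]]] :=
    @linking _ 'I_(leaf_bound t h) 'I_s (fun k => p' (lft (g0 k))) (fun l => q (rgt l)) _ _ _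
      (leaf_bound t h) _ hitsg.
  + by move=> i j d /p'P h1 /p'P h2; apply/injg0/injl/(fam_dP (st_fam st) h1 h2).
  + by move=> i j d /qQ h1 /qQ h2; apply/injr/(fam_dQ (st_fam st) h1 h2).
  + by move=> j; have [] := st_uniqQ st (rgt j).
  + by rewrite card_ord.
  have : immersed (onion_star t) D \/ hub x P Q h.
    apply: (@case_c_linked _ (lft \o (g0 \o g1)) (rgt \o g2) a a' b b' c _ _ _ ea eb djab t h (leqnn _)).
    - by move=> k l /injl/injg0/injg1.
    - by move=> k l /injr/injg2.
    - by move=> k l; apply: lr.
  by case=> ?; [apply: Or31|apply: Or33].
apply: Or32; exists (lft \o g), (rgt \o g'); split; try exact: inj_comp.
(* Of the nine pairs of pieces, [p'] against [q] is the one settled by [poor]. *)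
move=> k l d; rewrite /= (st_P st) (st_Q st) !mem_cat !inE.
have ne : lft (g k) <> rgt (g' l) by apply: lr.
have dp'q : d \in p' (lft (g k)) -> d \in q (rgt (g' l)) -> False by apply/hitsPn/poor.
case/or3P=> h0 /or3P[] h1.
- exact: qp h1 h0 (not_eq_sym ne).
- exact: PP (pP h0) (eP h1) ne.
- exact: stpq h0 h1.
- exact: QQ (eQ h0) (qQ h1) ne.
- exact: PP (eP h0) (eP h1) ne.
- exact: QQ (eQ h0) (q'Q h1) ne.
- exact: dp'q.
- exact: PP (p'P h0) (eP h1) ne.
- exact: p'q' h0 h1 ne.
Qed.

End CaseC.

(** Reversal exchanges the roles of P and Q, and turns the leftover [q] before [e] into a leftover
    after [e]. *)
Lemma stair_op (D : digraph) (x : vertices D) I (P Q p p' q q' : I -> seq (arcs D)) e :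
  stair x P Q p p' q q' e ->
  stair (D := op D) x (rev \o Q) (rev \o P) (rev \o q') (rev \o q) (rev \o p') (rev \o p) e.
Proof.
case=> -[xP xQ wP wQ uP uQ dP dQ] eP eQ pq.
split; first split => /=.
- by move=> i; rewrite map_rev mem_rev; apply: xQ.
- by move=> i; rewrite map_rev mem_rev; apply: xP.
- by move=> i; have [z wz] := wQ i; exists z; rewrite walk_op.
- by move=> i; have [z wz] := wP i; exists z; rewrite walk_op.
- by move=> i; rewrite rev_uniq.
- by move=> i; rewrite rev_uniq.
- by move=> i j a; rewrite !mem_rev; apply: dQ.
- by move=> i j a; rewrite !mem_rev; apply: dP.
- by move=> i /=; rewrite eQ rev_cat rev_cons -cats1 -catA.
- by move=> i /=; rewrite eP rev_cat rev_cons -cats1 -catA.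
- by move=> i j a /=; rewrite !mem_rev => ha hb; apply: pq hb ha.
Qed.

Lemma hub_op (D : digraph) (x : vertices D) I J (P : I -> seq (arcs D)) (Q : J -> seq (arcs D)) n :
  hub (D := op D) x (rev \o Q) (rev \o P) n -> hub x P Q n.
Proof.
case=> v [g [h [pre [suf [f [injg injh H1 H2 H3]]]]]]; exists v, h, g, (rev \o suf), (rev \o pre), f.
split=> //=.
- move=> k; have [h1 h2 h3 h4] := H1 k; split.
  + by rewrite -[P _]revK prefix_rev.
  + by rewrite -[Q _]revK suffix_rev.
  + by rewrite -walk_op revK.
  + by rewrite -walk_op revK.
- move=> k; have /= [h1 h2 h3] := H2 k; rewrite !mem_rev in h1 h2; split=> //.
  by rewrite /incident orbC.
- by move=> k l ne a; rewrite !mem_rev => ha hb; apply: (H3 l k) hb ha => /esym.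
Qed.

Lemma hub_comp (D : digraph) (x : vertices D) I J I' J' (P : I -> seq (arcs D))
    (Q : J -> seq (arcs D)) (r : I' -> I) (r' : J' -> J) n :
  injective r -> injective r' -> hub x (P \o r) (Q \o r') n -> hub x P Q n.
Proof.
move=> injr injr' [v [g [h [pre [suf [f [injg injh H1 H2 H3]]]]]]].
by exists v, (r \o g), (r' \o h), pre, suf, f; split=> //; apply: inj_comp.
Qed.

Lemma case_b (D : digraph) (x : vertices D) n (P Q p p' q q' : 'I_n -> seq (arcs D)) e t h
    (g : 'I_(case_a_bound t h) -> 'I_n) (O : 'I_(case_a_bound t h) -> seq (arcs D)) :
  stair x P Q p p' q q' e ->
  injective g -> (forall k, suffix (O k) (q (g k))) ->
  (forall k l, k <> l -> dj (O k) (p (g l))) ->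
  (forall k, case_a_bound t h <= #|[set j | (j != g k) && hits (O k) (p j)]|) ->
  immersed (onion_star t) D \/ hub x P Q h.
Proof.
move=> /stair_op st injg sufO djO hitsO.
have [||||/immersed_op|/hub_op] := @case_a (op D) x n _ _ _ _ _ _ _ st t h g (rev \o O).
- exact: injg.
- by move=> k; rewrite /= prefix_rev.
- by move=> k l ne; apply/dj_revl/dj_revr/djO.
- move=> k; apply: leq_trans (hitsO k) (subset_leq_card _).
  apply/subsetP => j; rewrite !inE => /andP[-> /hitsP[d d1 d2]].
  by apply/hitsP; exists d; rewrite mem_rev.
- by left.
- by right.
Qed.

Lemma stair_sub (D : digraph) (x : vertices D) I I' (P Q p p' q q' : I -> seq (arcs D)) e (g : I' -> I) :
  injective g -> stair x P Q p p' q q' e ->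
  stair x (P \o g) (Q \o g) (p \o g) (p' \o g) (q \o g) (q' \o g) (e \o g).
Proof.
move=> injg [fam eP eQ pq]; split=> /=; first exact: families_sub.
- by move=> i; apply: eP.
- by move=> i; apply: eQ.
- by move=> i j a; apply: pq.
Qed.

(** The form in which hubs are used: [pre] and [suf] are disjoint for all pairs of indices, at the
    price that the partner of the witness arc may lie outside the selected subfamily. *)
Definition split_hub (D : digraph) (x : vertices D) (I J : Type)
    (P : I -> seq (arcs D)) (Q : J -> seq (arcs D)) m :=
  exists v (g : 'I_m -> I) (h : 'I_m -> J) (pre suf : 'I_m -> seq (arcs D)),
  [/\ injective g /\ injective h,
      (forall k, prefix (pre k) (P (g k)) /\ walk x v (pre k)) /\
      (forall k, suffix (suf k) (Q (h k)) /\ walk v x (suf k)),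
      forall k, exists f j, [/\ f \in P (g k), f \in Q j & incident v f],
      forall k, exists f i, [/\ f \in P i, f \in Q (h k) & incident v f] &
      forall k l, dj (pre k) (suf l)].

Lemma hub_split (D : digraph) (x : vertices D) I J (P : I -> seq (arcs D)) (Q : J -> seq (arcs D)) m :
  hub x P Q (m + m) -> split_hub x P Q m.
Proof.
case=> v [g [h [pre [suf [f [injg injh H1 H2 H3]]]]]].
exists v, (g \o lshift m), (h \o @rshift m m), (pre \o lshift m), (suf \o @rshift m m).
split=> /=.
- by split=> k l; [move/injg/lshift_inj|move/injh/rshift_inj].
- by split=> k; [case: (H1 (lshift m k))|case: (H1 (rshift m k))].
- by move=> k; have [? ? ?] := H2 (lshift m k); exists (f (lshift m k)), (h (lshift m k)).
- by move=> k; have [? ? ?] := H2 (rshift m k); exists (f (rshift m k)), (g (rshift m k)).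
- by move=> k l; apply: H3 => /eqP; rewrite eq_lrshift.
Qed.

(* Each leftover [p' k] is cut where it has hit d other [q' l], each leftover [q k] where
   it has hit d other [p l] (counted backwards). The hits then have bounded degree, so
   on a large index set there are none, and either nothing was cut ([case_c]), or some
   leftovers keep meeting many walks outside of the set ([case_a] and its dual). *)
Lemma key t m : exists M, forall (D : digraph) (x : vertices D) (P Q : 'I_M -> seq (arcs D)),
  families x P Q ->
  [\/ immersed (onion_star t) D,
      exists (g g' : 'I_m -> 'I_M), [/\ injective g, injective g' &
        forall k l, dj (P (g k)) (Q (g' l))] |
      split_hub x P Q m].
Proof.
(* [h] is halved by [hub_split]. [s] meets both size conditions of [case_c]; [T2] leaves room for
   [case_b] or for two halves of size [s]; [T1] for [case_a] or for one more binary choice; [n]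
   comes from [indep] with out-degree [d + d], [M] from [rich_or_poor]. *)
pose h := m + m; pose L := leaf_bound t h; pose d := case_a_bound t h.
pose s := L + m + m * L; pose T2 := d + (s + s); pose T1 := d + (2 * T2).+1.
pose n := (2 * (d + d) + 1) * (2 * T1).+1.
pose M := n + m + (m * n + m).
exists M => D x P Q fam.
have [||[g injg hitsg]|[g [g' [injg injg' poor]]]] :=
  @rich_or_poor 'I_M 'I_M (fun k l => hits (P k) (Q l)) n m; try by rewrite card_ord /M; lia.
  2: by constructor 2; exists g, g'; split=> // k l; apply/hitsPn/poor.
have [|g1 [tau [p [p' [q [q' [e [injg1 injtau eP eQ pq]]]]]]]] :=
  @linking _ 'I_n 'I_M (P \o g) Q _ (fam_dQ fam) (fam_uQ fam) n (eq_leq (esym (card_ord n))) hitsg.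
  by move=> i j a h1 h2; apply/injg/(fam_dP fam h1 h2).
have inj1 : injective (g \o g1) by apply: inj_comp.
have st : stair x (P \o (g \o g1)) (Q \o tau) p p' q q' e.
  by split; [apply: families_sub|exact: eP|exact: eQ|move=> i j a; apply: pq].
suff : [\/ immersed (onion_star t) D,
      exists (r r' : 'I_m -> 'I_n), [/\ injective r, injective r' &
        forall k l, dj (P (g (g1 (r k)))) (Q (tau (r' l)))] |
      hub x (P \o (g \o g1)) (Q \o tau) h].
  case=> [H|[r [r' [injr injr' djr]]]|H]; first by constructor 1.
    constructor 2; exists (g \o (g1 \o r)), (tau \o r').
    by split; [exact: inj_comp injg (inj_comp injg1 injr)|exact: inj_comp|].
  constructor 3; apply: hub_split; exact: hub_comp inj1 injtau H.
have /choice[O OP] k : exists O : seq (arcs D) * seq (arcs D), [/\ p' k = O.1 ++ O.2,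
    #|[set l | (l != k) && hits O.1 (q' l)]| <= d &
    O.2 = [::] \/ #|[set l | (l != k) && hits O.1 (q' l)]| = d].
  have [|b1 [b2 [eb le1 h2]]] := @trunc_prefix _ _ (fun l => if l == k then [::] else q' l) d (p' k).
    move=> i j a; case: ifP; case: ifP => // _ _ /(st_q'Q st) h1 /(st_q'Q st).
    exact: (fam_dQ (st_fam st)) h1.
  have eqS : [set j | hits b1 (if j == k then [::] else q' j)] = [set l | (l != k) && hits b1 (q' l)].
    by apply/setP => l; rewrite !inE; case: eqP => //= _; apply/negP => /hitsP[].
  by exists (b1, b2); rewrite -eqS.
have /choice[N NP] k : exists N : seq (arcs D) * seq (arcs D), [/\ q k = N.1 ++ N.2,
    #|[set l | (l != k) && hits N.2 (p l)]| <= d &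
    N.1 = [::] \/ #|[set l | (l != k) && hits N.2 (p l)]| = d].
  have [|b1 [b2 [eb le1 h2]]] := @trunc_suffix _ _ (fun l => if l == k then [::] else p l) d (q k).
    move=> i j a; case: ifP; case: ifP => // _ _ /(st_pP st) h1 /(st_pP st).
    exact: (fam_dP (st_fam st)) h1.
  have eqS : [set j | hits b2 (if j == k then [::] else p j)] = [set l | (l != k) && hits b2 (p l)].
    by apply/setP => l; rewrite !inE; case: eqP => //= _; apply/negP => /hitsP[].
  by exists (b1, b2); rewrite -eqS.
have [|k||g2 injg2 ind] := @indep 'I_n
    (fun k l => (l != k) && (hits (O k).1 (q' l) || hits (N k).2 (p l))) (d + d) (2 * T1).+1.
- by move=> k; rewrite eqxx.
- have [_ leO _] := OP k; have [_ leN _] := NP k.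
  apply: leq_trans (leq_add leO leN); apply: leq_trans (leq_card_setU _ _).
  by apply: subset_leq_card; apply/subsetP => l; rewrite !inE -andb_orr.
- by rewrite card_ord.
have {ind}ind k l : k <> l -> dj (O (g2 k)).1 (q' (g2 l)) /\ dj (N (g2 k)).2 (p (g2 l)).
  move=> ne; have := ind k l; have -> /= : g2 l != g2 k by apply/eqP => /injg2 e0; apply: ne.
  by rewrite negb_or => /andP[/hitsPn ? /hitsPn ?].
have [|g3 injg3 [full|part]] := @pigeon_bool 'I_(2 * T1).+1 (fun k => (O (g2 k)).2 == [::]) T1.
- by rewrite card_ord.
- have [|g4 injg4 [full'|part']] :=
    @pigeon_bool 'I_T1 (fun k => (N (g2 (g3 k))).1 == [::]) T2.
  + by rewrite card_ord /T1; lia.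
  + have [r injr] : exists r : 'I_(s + s) -> 'I_T2, injective r.
      by apply: inj_widen; rewrite /T2; lia.
    pose r' := g2 \o (g3 \o (g4 \o r)).
    have injg34 : injective (g3 \o (g4 \o r)) by exact: inj_comp injg3 (inj_comp injg4 injr).
    have injr' : injective r' by apply: inj_comp.
    have eqO k : (O (r' k)).1 = p' (r' k).
      by have [-> _ _] := OP (r' k); rewrite (eqP (full (g4 (r k)))) cats0.
    have eqN k : (N (r' k)).2 = q (r' k).
      by have [-> _ _] := NP (r' k); rewrite (eqP (full' (r k))).
    have [||||H|[r1 [r2 [inj_r1 inj_r2 H]]]|H] := @case_c _ _ _ _ _ _ _ _ _ _ (stair_sub injr' st) _ _ t h m s erefl.
    * move=> k l a /=; rewrite -eqO => ha hb ne.
      have ne' : g3 (g4 (r k)) <> g3 (g4 (r l)) by move/injg34.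
      by have [/(_ a ha hb)] := ind _ _ ne'.
    * move=> k l a /=; rewrite -eqN => ha hb ne.
      have ne' : g3 (g4 (r k)) <> g3 (g4 (r l)) by move/injg34.
      by have [_ /(_ a ha hb)] := ind _ _ ne'.
    * by rewrite /s -/L; lia.
    * by rewrite /s -/L; lia.
    * by constructor 1.
    * by constructor 2; exists (r' \o r1), (r' \o r2); split=> //; apply: inj_comp.
    * constructor 3; exact: (@hub_comp _ _ _ _ _ _ (P \o (g \o g1)) (Q \o tau) r' r' _ injr' injr').
  + have [r injr] : exists r : 'I_d -> 'I_T2, injective r.
      by apply: inj_widen; rewrite /T2; lia.
    have injg34 : injective (g3 \o (g4 \o r)) by exact: inj_comp injg3 (inj_comp injg4 injr).
    have [||||H|H] := @case_b _ _ _ _ _ _ _ _ _ _ t h (g2 \o (g3 \o (g4 \o r)))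
      (fun k => (N (g2 (g3 (g4 (r k))))).2) st.
    * exact: inj_comp.
    * by move=> k /=; have [-> _ _] := NP (g2 (g3 (g4 (r k)))); apply: suffix_suffix.
    * move=> k l ne.
      have ne' : g3 (g4 (r k)) <> g3 (g4 (r l)) by move/injg34.
      by have [] := ind _ _ ne'.
    * move=> k; have [_ _ [e0|eL]] := NP (g2 (g3 (g4 (r k)))); last by rewrite eL.
      by have := part' (r k); rewrite e0.
    * by constructor 1.
    * by constructor 3.
- have [r injr] : exists r : 'I_d -> 'I_T1, injective r.
    by apply: inj_widen; rewrite /T1; lia.
  have injg34 : injective (g3 \o r) by exact: inj_comp.
  have [||||H|H] := @case_a _ _ _ _ _ _ _ _ _ _ st t h (g2 \o (g3 \o r))
      (fun k => (O (g2 (g3 (r k)))).1).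
  + exact: inj_comp.
  + by move=> k /=; have [-> _ _] := OP (g2 (g3 (r k))); apply: prefix_prefix.
  + move=> k l ne.
    have ne' : g3 (r k) <> g3 (r l) by move/injg34.
    by have [] := ind _ _ ne'.
  + move=> k; have [_ _ [e0|eL]] := OP (g2 (g3 (r k))); last by rewrite eL.
    by have := part (r k); rewrite e0.
  + by constructor 1.
  + by constructor 3.
Qed.

(** * Closed walks through common vertices, and the order of hubs along a path *)

Lemma prefix_leq (T : eqType) (s1 s2 s : seq T) :
  prefix s1 s -> prefix s2 s -> size s1 <= size s2 -> prefix s1 s2.
Proof. by rewrite !prefixE => /eqP e1 /eqP e2 le; rewrite -e2 take_takel // e1. Qed.

Lemma suffix_leq (T : eqType) (s1 s2 s : seq T) :
  suffix s1 s -> suffix s2 s -> size s1 <= size s2 -> suffix s1 s2.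
Proof.
by rewrite -!prefix_rev => h1 h2 le; apply: prefix_leq h1 h2 _; rewrite !size_rev.
Qed.

Section Loops.

Variables (D : digraph) (x : vertices D).
Implicit Types (u v : vertices D) (p q s : seq (arcs D)) (f : arcs D).

Lemma split_at_tail z p v : walk x z p -> v \in tails p ->
  exists s1 s2, [/\ p = s1 ++ s2, walk x v s1 & walk v z s2].
Proof.
move=> wp /mapP[f /mem_split[s1 [s2 e]] ->].
by move: wp; rewrite e => /walk_tail[h1 h2]; exists s1, (f :: s2).
Qed.

Lemma split_at_head z p v : walk x z p -> v \in heads p ->
  exists s1 s2, [/\ p = s1 ++ s2, walk x v s1 & walk v z s2].
Proof.
move=> wp /mapP[f /mem_split[s1 [s2 e]] ->].
by move: wp; rewrite e => /walk_head[h1 h2]; exists (s1 ++ [:: f]), s2; rewrite -catA.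
Qed.

(** Two disjoint closed walks through [v] contain two paths from x to [v] and two back, enough for a
    leaf of either kind; each of the [t + t] vertices gets its own two walks. *)
Lemma immersed_fat t m (F : 'I_m -> seq (arcs D)) (V : seq (vertices D)) :
  (t + t) * 2 <= m -> (forall i, uniq (F i)) -> (forall i j, i <> j -> dj (F i) (F j)) ->
  uniq V -> size V = t + t ->
  (forall i v, v \in V ->
     x != v /\ exists s1 s2, [/\ F i = s1 ++ s2, walk x v s1 & walk v x s2]) ->
  immersed (onion_star t) D.
Proof.
move=> le_m uF dF uV sV splitF.
have [h injh] : exists h : 'I_(t + t) * bool -> 'I_m, injective h.
  have le : #|{: 'I_(t + t) * bool}| <= m by rewrite card_prod card_ord card_bool.
  exists (fun k => widen_ord le (enum_rank k)) => k l /(congr1 val) /= /val_inj.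
  exact: enum_rank_inj.
pose w (k : 'I_(t + t)) := nth x V k.
have wV k : w k \in V by apply: mem_nth; rewrite sV.
have xw k : x != w k by have [] := splitF (h (k, true)) _ (wV k).
have injw : injective w.
  by move=> k l /eqP; rewrite /w nth_uniq ?sV // => /eqP/val_inj.
pose S k := F (h (k, true)) ++ F (h (k, false)).
have dS k l : k <> l -> dj (S k) (S l).
  by move=> ne; do ?[apply/dj_catl; split]; do ?[apply/dj_catr; split]; apply: dF => /injh[].
have dF2 k : dj (F (h (k, true))) (F (h (k, false))) by apply: dF => /injh[].
have yl k : yleaf x (w k) (S k).
  have [_ [s1 [s2 [e1 w1 w2]]]] := splitF (h (k, true)) _ (wV k).
  have [_ [s3 [s4 [e3 w3 w4]]]] := splitF (h (k, false)) _ (wV k).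
  have := dF2 k; rewrite e1 e3 => /dj_catl[/dj_catr[d13 _] /dj_catr[d23 _]].
  have := uF (h (k, true)); rewrite e1 => /uniq_catP[_ _ d12].
  exists s1, s3, s2; split=> //; rewrite /S ?e1 ?e3.
    by split; [|split]; submem.
  by split=> //; split=> //; apply: dj_sym.
have zl k : zleaf x (w k) (S k).
  have [_ [s1 [s2 [e1 w1 w2]]]] := splitF (h (k, true)) _ (wV k).
  have [_ [s3 [s4 [e3 w3 w4]]]] := splitF (h (k, false)) _ (wV k).
  have := dF2 k; rewrite e1 e3 => /dj_catl[/dj_catr[d13 d14] /dj_catr[d23 d24]].
  have := uF (h (k, true)); rewrite e1 => /uniq_catP[_ _ d12].
  exists s2, s4, s1; split=> //; rewrite /S ?e1 ?e3.
    by split; [|split]; submem.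
  by split=> //; split=> //; apply: dj_sym.
apply: (@immersed_leaves _ t x (w \o lshift t) (w \o @rshift t t) (S \o lshift t) (S \o @rshift t t)) => //=.
- by move=> i j /injw/lshift_inj.
- by move=> i j /injw/rshift_inj.
- by move=> i j; rewrite (inj_eq injw) eq_lrshift.
- by move=> i j ne; apply: dS => /lshift_inj.
- by move=> i j ne; apply: dS => /rshift_inj.
- by move=> i j; apply: dS => /eqP; rewrite eq_lrshift.
Qed.

(** A simple [P i] has at most one arc into [v] and one out of it, each on at most one [Q j]. So no
    [P i] is related to 3 of the Q's, and [rich_or_poor] leaves the poor alternative. *)
Lemma thin_at m n (P Q : 'I_n -> seq (arcs D)) v :
  3 + m + (m * 3 + m) <= n ->
  (forall i, uniq (tails (P i))) -> (forall i, uniq (heads (P i))) ->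
  (forall i j a, a \in Q i -> a \in Q j -> i = j) ->
  exists g h : 'I_m -> 'I_n, [/\ injective g, injective h &
    forall k l a, a \in P (g k) -> a \in Q (h l) -> ~~ incident v a].
Proof.
move=> le_n uT uH dQ.
have inj_in (T : finType) (f : arcs D -> T) s a b :
    uniq (map f s) -> a \in s -> b \in s -> f a = f b -> a = b.
  move=> us ha hb e; rewrite -(nth_index a ha) -(nth_index a hb); congr nth; apply/eqP.
  by rewrite -(nth_uniq (f a) _ _ us) ?size_map ?index_mem // !(nth_map a) ?index_mem //
    !nth_index // e.
have [||[g injg rich]|[g [h [injg injh poor]]]] := @rich_or_poor 'I_n 'I_n
    (fun i j => has (fun a => (a \in Q j) && incident v a) (P i)) 3 m.
- by rewrite card_ord; lia.
- by rewrite card_ord; lia.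
- have := rich ord0; rewrite leqNgt => /negP[]; rewrite ltnS.
  set i := g ord0.
  apply: (@leq_trans #|[set j | has (fun a => (a \in Q j) && (arc_tail a == v)) (P i)] :|:
     [set j | has (fun a => (a \in Q j) && (arc_head a == v)) (P i)]|).
    apply: subset_leq_card; apply/subsetP => j; rewrite !inE => /hasP[a aP /andP[aQ /orP[]e]].
      by apply/orP; left; apply/hasP; exists a => //; rewrite aQ.
    by apply/orP; right; apply/hasP; exists a => //; rewrite aQ.
  apply: leq_trans (leq_card_setU _ _) _; rewrite -[2]/(1 + 1); apply: leq_add.
    apply/card_le1_eqP => j l; rewrite !inE => /hasP[a aP /andP[aQ /eqP ea]].
    move=> /hasP[b bP /andP[bQ /eqP eb]]; apply/esym/(dQ _ _ _ aQ).
    by rewrite (inj_in _ _ _ a b (uT i)) // ea eb.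
  apply/card_le1_eqP => j l; rewrite !inE => /hasP[a aP /andP[aQ /eqP ea]].
  move=> /hasP[b bP /andP[bQ /eqP eb]]; apply/esym/(dQ _ _ _ aQ).
  by rewrite (inj_in _ _ _ a b (uH i)) // ea eb.
- exists g, h; split=> // k l a aP aQ; apply: contra (poor k l) => inc.
  by apply/hasP; exists a; rewrite ?aQ.
Qed.

(** [f] lies before [s] on [q], and so does its end [v]: if [v] is the head of [f], the next arc
    still precedes [s], for otherwise that head would be [u]. As tails are distinct, [v] is not on
    [s], so the suffix starting at [v] is the longer one. *)
Lemma suffix_before z q s s' u v f :
  walk z x q -> uniq (tails q) -> suffix s q -> walk u x s ->
  f \in q -> f \notin s -> ~~ incident u f -> incident v f ->
  suffix s' q -> walk v x s' -> v != x ->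
  [/\ v \notin tails s, suffix s s' & v \in tails s'].
Proof.
move=> wq uq ss ws fq fs nu iv ss' ws' vx.
have vs' : v \in tails s'.
  by case: (s') ws' => [|a r] /=; [rewrite (negPf vx)|case/andP=> /eqP-> _; apply: mem_head].
have vs : v \notin tails s.
  move/suffixP: ss => [c eq]; move: uq fq; rewrite eq map_cat mem_cat (negPf fs) orbF.
  move=> /uniq_catP[_ _ dcs] fc; apply/negP; apply: dcs.
  have [c1 [c2 ec]] := mem_split fc.
  case/orP: iv => /eqP <-; first exact: map_f.
  move: wq; rewrite eq ec -catA => /walk_head[_].
  case: c2 ec => [|d c2] ec /=; last first.
    by case/andP=> /eqP <- _; rewrite map_cat mem_cat /= !inE eqxx !orbT.
  move=> wf; suff ef : arc_head f = u by move: nu; rewrite /incident ef eqxx orbT.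
  by case: (s) ws wf => [|a r] /=; [move=> /eqP-> /eqP|move=> /andP[/eqP<- _] /andP[/eqP]].
split=> //; have [le|lt] := leqP (size s) (size s'); first exact: suffix_leq ss ss' le.
have /suffixP[r er] := suffix_leq ss' ss (ltnW lt).
by case/negP: vs; rewrite er map_cat mem_cat vs' orbT.
Qed.

End Loops.

Lemma prefix_before (D : digraph) (x z u v : vertices D) (q s s' : seq (arcs D)) (f : arcs D) :
  walk x z q -> uniq (heads q) -> prefix s q -> walk x u s ->
  f \in q -> f \notin s -> ~~ incident u f -> incident v f ->
  prefix s' q -> walk x v s' -> v != x ->
  [/\ v \notin heads s, prefix s s' & v \in heads s'].
Proof.
move=> wq uq ps ws fq fs nu iv ps' ws' vx.
have inc (w : vertices D) : incident (D := op D) w f = incident w f by rewrite /incident orbC.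
have [] := @suffix_before (op D) x z (rev q) (rev s) (rev s') u v f;
  rewrite ?walk_op ?suffix_rev ?mem_rev ?inc //.
  by rewrite map_rev rev_uniq.
by rewrite !map_rev !mem_rev.
Qed.

(** * Iterating over hubs *)

Record simple_families (D : digraph) (x : vertices D) (I J : Type)
    (P : I -> seq (arcs D)) (Q : J -> seq (arcs D)) : Prop := SimpleFamilies {
  sf_fam : families x P Q;
  sf_tP : forall i, uniq (tails (P i));
  sf_hP : forall i, uniq (heads (P i));
  sf_tQ : forall j, uniq (tails (Q j)) }.

Lemma simple_sub (D : digraph) (x : vertices D) (I J I' J' : Type)
    (P : I -> seq (arcs D)) (Q : J -> seq (arcs D)) (g : I' -> I) (h : J' -> J) :
  injective g -> injective h -> simple_families x P Q -> simple_families x (P \o g) (Q \o h).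
Proof. by move=> injg injh [? ? ? ?]; split=> //=; apply: families_sub. Qed.

Lemma shared_incident (D : digraph) (x : vertices D) (I J : Type)
    (P : I -> seq (arcs D)) (Q : J -> seq (arcs D)) i j f v :
  families x P Q -> f \in P i -> f \in Q j -> incident v f -> v != x.
Proof.
move=> fam fP fQ /orP[]/eqP <-; apply/eqP => e.
  by have := fam_xQ fam j; rewrite -e map_f.
by have := fam_xP fam i; rewrite -e map_f.
Qed.

(* [V] collects the hubs found so far on the parts [suf j], and [r] more of them
   would make an onion star. *)
Lemma free_hub t m r : exists M, forall (D : digraph) (x v : vertices D) (G : arcs D -> Prop)
    (P pre Q suf : 'I_M -> seq (arcs D)) (V : seq (vertices D)),
  simple_families x P Q -> (forall i j a, a \in P i -> a \in Q j -> G a) ->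
  (forall i, prefix (pre i) (P i) /\ walk x v (pre i)) ->
  (forall j, suffix (suf j) (Q j) /\ walk v x (suf j)) ->
  (forall i j, dj (pre i) (suf j)) ->
  (forall i j a, a \in P i -> a \in Q j -> ~~ incident v a) ->
  (forall i, exists f, [/\ f \in P i, G f & incident v f]) ->
  uniq V -> size V + r = t + t -> (forall j, {subset V <= tails (suf j)}) ->
  immersed (onion_star t) D \/
  exists v' (g h : 'I_m -> 'I_M) (pre' suf' : 'I_m -> seq (arcs D)),
  [/\ injective g /\ injective h,
      (forall k, prefix (pre' k) (P (g k)) /\ walk x v' (pre' k)),
      (forall k, suffix (suf' k) (Q (h k)) /\ walk v' x (suf' k)),
      (forall k l, dj (pre' k) (Q (h l))) &
      (forall k, exists f, [/\ f \in P (g k), G f & incident v' f])].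
Proof.
elim: r => [|r [M' IH]].
  exists ((t + t) * 2) => D x v G P pre Q suf V [fam _ _ _] _ preP sufP djps _ _ uV sV subV.
  have pP i a : a \in pre i -> a \in P i.
    by have [/prefixP[s ->] _] := preP i; rewrite mem_cat => ->.
  have sQ i a : a \in suf i -> a \in Q i.
    by have [/suffixP[s ->] _] := sufP i; rewrite mem_cat => ->; rewrite orbT.
  left; apply: (@immersed_fat _ x t _ (fun i => pre i ++ suf i) V) => //.
  - move=> i; apply/uniq_catP; split; last exact: djps.
      by have [/prefixP[s e] _] := preP i; have := fam_uP fam i; rewrite e => /uniq_catP[].
    by have [/suffixP[s e] _] := sufP i; have := fam_uQ fam i; rewrite e => /uniq_catP[].
  - move=> i j ne; apply/dj_catl; split; apply/dj_catr; split=> //.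
    + by move=> a /pP h1 /pP h2; apply/ne/(fam_dP fam h1 h2).
    + by apply: dj_sym.
    + by move=> a /sQ h1 /sQ h2; apply/ne/(fam_dQ fam h1 h2).
  - by rewrite -sV addn0.
  - move=> i w /(subV i) wi; split.
      case/mapP: wi => a /sQ aQ ->; apply: contraNneq (fam_xQ fam i) => ->; exact: map_f.
    apply: split_at_tail; last by rewrite map_cat mem_cat wi orbT.
    by apply: walk_cat (proj2 (preP i)) (proj2 (sufP i)).
(* Room for [thin_at] to keep [M'] indices for the next round, and for the [m] indices of the
   disjoint outcome. *)
pose m1 := 3 + M' + (M' * 3 + M') + m.
have [M keyM] := key t m1.
exists M => D x v G P pre Q suf V [fam uT uH uTQ] PQG preP sufP djps thin hubP uV sV subV.
have preP' i a : a \in pre i -> a \in P i.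
  by have [/prefixP[s ->] _] := preP i; rewrite mem_cat => ->.
have fam_pre : families x pre Q.
  case: fam => xP xQ wP wQ uP uQ dP dQ; split=> //.
  - move=> i; apply: contra (xP i) => /mapP[a /preP' ha ->]; exact: map_f.
  - by move=> i; exists v; case: (preP i).
  - by move=> i; have [/prefixP[s e] _] := preP i; have := uP i; rewrite e => /uniq_catP[].
  - by move=> i j a /preP' h1 /preP'; apply: dP h1.
(* Applied to [pre] instead of [P], so the disjoint outcome says that the present hub [v] is free of
   Q. *)
have [?|[g [h [injg injh djgh]]]|] := keyM D x pre Q fam_pre; first by left.
  have [r1 injr1] : exists r1 : 'I_m -> 'I_m1, injective r1 by apply: inj_widen; rewrite /m1; lia.
  right; exists v, (g \o r1), (h \o r1), (pre \o (g \o r1)), (suf \o (h \o r1)); split=> //=.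
  by split; apply: inj_comp.
case=> v' [g [h [pre' [suf' [[injg injh] [preP2 sufP2] hubP2 hubQ2 djps2]]]]].
have [||g1 [h1 [injg1 injh1 thin']]] :=
  @thin_at D M' m1 (P \o g) (Q \o h) v' _ (fun i => uT _) (fun i => uH _).
- by rewrite /m1; lia.
- by move=> i j a h1 h2; apply/injh/(fam_dQ fam h1 h2).
(* The arc witnessing [v'] lies on some [pre i], hence not on [suf]; so [v'] comes before the old
   hub on Q and is new. *)
have before j : [/\ v' \notin tails (suf (h j)), suffix (suf (h j)) (suf' j) & v' \in tails (suf' j)].
  have [f [i [fp fQ iv']]] := hubQ2 j; have [ss ws] := sufP (h j); have [ss' ws'] := sufP2 j.
  have [z wz] := fam_wQ fam (h j).
  apply: (suffix_before wz (uTQ _) ss ws fQ _ _ iv' ss' ws').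
  - by apply/negP => /(djps i (h j) f fp).
  - exact: thin (preP' _ _ fp) fQ.
  - exact: shared_incident fam_pre fp fQ iv'.
have injgg : injective (g \o g1) by exact: inj_comp.
have injhh : injective (h \o h1) by exact: inj_comp.
have [||||||||||?|[v2 [g2 [h2 [pre2 [suf2 [[injg2 injh2] H1 H2 H3 H4]]]]]]] :=
  IH D x v' G (P \o (g \o g1)) (pre' \o g1) (Q \o (h \o h1)) (suf' \o h1) (v' :: V).
- by apply: simple_sub.
- by move=> i j a; apply: PQG.
- move=> i /=; have [/prefixP[s e] w] := preP2 (g1 i); split=> //.
  by have [/prefixP[s' ->] _] := preP (g (g1 i)); rewrite e -catA; apply: prefix_prefix.
- by move=> j; apply: sufP2.
- by move=> i j; apply: djps2.
- by move=> i j a; apply: thin'.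
- move=> i; have [f [j [fp fQ iv']]] := hubP2 (g1 i); exists f.
  by split=> //; [apply: preP'|apply: PQG fQ; apply: preP' fp].
- have j0 : 'I_m1 by exists 0; rewrite /m1.
  by rewrite /= uV andbT; have [nv _ _] := before j0; apply: contra nv => /subV.
- by rewrite /= addSnnS.
- move=> j w; have [_ /suffixP[s e] vs] := before (h1 j).
  by rewrite inE => /orP[/eqP-> //|/(subV (h (h1 j))) ws] /=; rewrite e map_cat mem_cat ws orbT.
- by left.
- right; exists v2, ((g \o g1) \o g2), ((h \o h1) \o h2), pre2, suf2; split=> //.
  by split; apply: inj_comp.
Qed.

(* [U] collects the hubs found so far on the parts [pre i], and [r] more of them
   would make an onion star. *)
Lemma disjoint_or_immersed t m r : exists M, forall (D : digraph) (x u : vertices D)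
    (P pre Q suf : 'I_M -> seq (arcs D)) (U : seq (vertices D)),
  simple_families x P Q ->
  (forall i, prefix (pre i) (P i) /\ walk x u (pre i)) ->
  (forall j, suffix (suf j) (Q j) /\ walk u x (suf j)) ->
  (forall i j, dj (pre i) (Q j)) ->
  (forall i j a, a \in P i -> a \in Q j -> ~~ incident u a) ->
  uniq U -> size U + r = t + t -> (forall i, {subset U <= heads (pre i)}) ->
  immersed (onion_star t) D \/
  exists (g h : 'I_m -> 'I_M),
  [/\ injective g, injective h & (forall k l, dj (P (g k)) (Q (h l)))].
Proof.
elim: r => [|r [M' IH]].
  exists ((t + t) * 2) => D x u P pre Q suf U [fam _ _ _] preP sufP djps _ uU sU subU.
  have pP i a : a \in pre i -> a \in P i.
    by have [/prefixP[s ->] _] := preP i; rewrite mem_cat => ->.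
  have sQ i a : a \in suf i -> a \in Q i.
    by have [/suffixP[s ->] _] := sufP i; rewrite mem_cat => ->; rewrite orbT.
  have djps' i j : dj (pre i) (suf j) by move=> a h1 /sQ; apply: djps h1.
  left; apply: (@immersed_fat _ x t _ (fun i => pre i ++ suf i) U) => //.
  - move=> i; apply/uniq_catP; split; last exact: djps'.
      by have [/prefixP[s e] _] := preP i; have := fam_uP fam i; rewrite e => /uniq_catP[].
    by have [/suffixP[s e] _] := sufP i; have := fam_uQ fam i; rewrite e => /uniq_catP[].
  - move=> i j ne; apply/dj_catl; split; apply/dj_catr; split=> //.
    + by move=> a /pP h1 /pP h2; apply/ne/(fam_dP fam h1 h2).
    + by apply: dj_sym.
    + by move=> a /sQ h1 /sQ h2; apply/ne/(fam_dQ fam h1 h2).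
  - by rewrite -sU addn0.
  - move=> i w /(subU i) wi; split.
      case/mapP: wi => a /pP aP ->; apply: contraNneq (fam_xP fam i) => ->; exact: map_f.
    apply: split_at_head; last by rewrite map_cat mem_cat wi.
    by apply: walk_cat (proj2 (preP i)) (proj2 (sufP i)).
pose m2 := 3 + M' + (M' * 3 + M').
(* The inner iteration starts with no hubs at all, so it needs all [t + t] rounds. *)
have [M1 inner] := free_hub t m2 (t + t).
pose m1 := 3 + M1 + (M1 * 3 + M1) + m.
have [M keyM] := key t m1.
exists M => D x u P pre Q suf U sfam preP sufP djps thin uU sU subU.
have [fam uT uH uTQ] := sfam.
have [?|[g [h [injg injh djgh]]]|] := keyM D x P Q fam; first by left.
  have [r1 injr1] : exists r1 : 'I_m -> 'I_m1, injective r1 by apply: inj_widen; rewrite /m1; lia.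
  by right; exists (g \o r1), (h \o r1); split=> //=; apply: inj_comp.
case=> v [g [h [pre1 [suf1 [[injg injh] [preP1 sufP1] hubP1 hubQ1 djps1]]]]].
have [||g1 [h1 [injg1 injh1 thin1]]] :=
  @thin_at D M1 m1 (P \o g) (Q \o h) v _ (fun i => uT _) (fun i => uH _).
- by rewrite /m1; lia.
- by move=> i j a a1 a2; apply/injh/(fam_dQ fam a1 a2).
have injgg : injective (g \o g1) by exact: inj_comp.
have injhh : injective (h \o h1) by exact: inj_comp.
(* [G] refers to the full families, so witness arcs stay valid when the inner iteration drops their
   partner Q. *)
pose G a := exists i j, a \in P i /\ a \in Q j.
have [||||||||||?|[v2 [g2 [h2 [pre2 [suf2 [[injg2 injh2] preP2 sufP2 dj2 hub2]]]]]]] :=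
  inner D x v G (P \o (g \o g1)) (pre1 \o g1) (Q \o (h \o h1)) (suf1 \o h1) [::].
- exact: simple_sub.
- by move=> i j a a1 a2; exists (g (g1 i)), (h (h1 j)).
- by move=> i; apply: preP1.
- by move=> j; apply: sufP1.
- by move=> i j; apply: djps1.
- by move=> i j a; apply: thin1.
- move=> i; have [f [j [fP fQ inc]]] := hubP1 (g1 i); exists f; split=> //.
  by exists (g (g1 i)), j.
- by [].
- by [].
- by move=> j w; rewrite in_nil.
- by left.
pose gg := (g \o g1) \o g2; pose hh := (h \o h1) \o h2.
have injg' : injective gg by exact: inj_comp.
have injh' : injective hh by exact: inj_comp.
have [||g3 [h3 [injg3 injh3 thin3]]] :=
  @thin_at D M' m2 (P \o gg) (Q \o hh) v2 _ (fun i => uT _) (fun i => uH _).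
- by rewrite /m2; lia.
- by move=> i j a a1 a2; apply/injh'/(fam_dQ fam a1 a2).
(* The arc at [v2] lies on some Q, hence not on [pre], which avoids every Q; so [v2] lies beyond [u]
   on P. *)
have before k : [/\ v2 \notin heads (pre (gg k)), prefix (pre (gg k)) (pre2 k) & v2 \in heads (pre2 k)].
  have [f [fP [i [j [fP' fQ]]] inc]] := hub2 k.
  have [ps ws] := preP (gg k); have [ps' ws'] := preP2 k; have [z wz] := fam_wP fam (gg k).
  apply: (prefix_before wz (uH _) ps ws fP _ _ inc ps' ws').
  - by apply/negP => /djps; apply; apply: fQ.
  - exact: thin fP' fQ.
  - exact: shared_incident fam fP' fQ inc.
have [||||||||?|[g4 [h4 [injg4 injh4 dj4]]]] :=
  IH D x v2 (P \o (gg \o g3)) (pre2 \o g3) (Q \o (hh \o h3)) (suf2 \o h3) (v2 :: U).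
- by apply: simple_sub => //; exact: inj_comp.
- by move=> i; apply: preP2.
- by move=> j; apply: sufP2.
- by move=> i j; apply: dj2.
- by move=> i j a; apply: thin3.
- have j0 : 'I_m2 by exists 0; rewrite /m2.
  by rewrite /= uU andbT; have [nv _ _] := before j0; apply: contra nv => /subU.
- by rewrite /= addSnnS.
- move=> k w; have [_ /prefixP[s e] vs] := before (g3 k).
  by rewrite inE => /orP[/eqP-> //|/(subU (gg (g3 k))) ws] /=; rewrite e map_cat mem_cat ws.
- by left.
- right; exists ((gg \o g3) \o g4), ((hh \o h3) \o h4); split=> //.
  + by apply: inj_comp => //; exact: inj_comp.
  + by apply: inj_comp => //; exact: inj_comp.
Qed.

Lemma simple_of_disjoint_paths (D : digraph) (x y : vertices D) m : m <= mu x y ->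
  exists P : 'I_m -> seq (arcs D),
  [/\ forall i, walk x y (P i), forall i, uniq (x :: heads (P i)) &
      forall i j a, a \in P i -> a \in P j -> i = j].
Proof.
move=> le_m; have [P [pathP djP]] := mu_attained x y.
have /choice[P' hP'] i := walk_simple (is_path_walk (pathP i)).
exists (P' \o widen_ord le_m); split=> /=.
- by move=> i; case: (hP' (widen_ord le_m i)).
- by move=> i; case: (hP' (widen_ord le_m i)).
- move=> i j a; case: (hP' (widen_ord le_m i)) => /(_ a) si _ _.
  case: (hP' (widen_ord le_m j)) => /(_ a) sj _ _ /si ai /sj aj.
  apply: contrapT => ne; have := djP (widen_ord le_m i) (widen_ord le_m j) _ a ai.
  by rewrite aj => H; have : false by apply: H => /(congr1 val)/= /val_inj.
Qed.

Theorem theorem1p4 :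
  exists g : nat -> nat -> nat,
    (forall t k : nat, 0 < t -> 0 < k -> 0 < g t k) /\
    forall (D : digraph) (x y : vertices D) (t k : nat),
      0 < t -> 0 < k ->
      x <> y ->
      g t k < mu x y ->
      g t k < mu y x ->
      immersed (onion_star t) D \/
      exists P : 'I_k + 'I_k -> seq (arcs D),
        [/\ forall i : 'I_k, is_path x y (P (inl i)),
            forall i : 'I_k, is_path y x (P (inr i)) &
            arc_disjoint P].
Proof.
have /choice[g gP] (tk : nat * nat) := disjoint_or_immersed tk.1 tk.2 (tk.1 + tk.1).
(* The successor makes the bound positive, as [disjoint_or_immersed] says nothing about the sign of
   its own. *)
exists (fun t k => (g (t, k)).+1); split=> // D x y t k _ _ /eqP ne lt1 lt2.
have [P [wP sP dP]] := simple_of_disjoint_paths (ltnW (ltnW lt1)).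
have [Q [wQ sQ dQ]] := simple_of_disjoint_paths (ltnW (ltnW lt2)).
have uTP i : uniq (tails (P i)).
  by have := sP i; rewrite (walk_verts (wP i)) rcons_uniq => /andP[].
have uTQ i : x \notin tails (Q i) /\ uniq (tails (Q i)).
  by have := sQ i; rewrite (walk_verts (wQ i)) rcons_uniq => /andP[].
have uHP i : x \notin heads (P i) /\ uniq (heads (P i)) by apply/andP; apply: sP.
have fam : families x P Q.
  split=> //.
  - by move=> i; case: (uHP i).
  - by move=> i; case: (uTQ i).
  - by move=> i; exists y.
  - by move=> i; exists y.
  - by move=> i; apply: map_uniq (uTP i).
  - by move=> i; have [_ /map_uniq] := uTQ i.
(* The outer iteration starts at the trivial hub [x] with empty initial and final parts; no arc
   common to a P and a Q touches [x]. *)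
have [||||||||?|[g1 [g2 [inj1 inj2 dj12]]]] :=
  gP (t, k) D x x P (fun _ => [::]) Q (fun _ => [::]) [::].
- split=> //; first by move=> i; case: (uHP i).
  by move=> i; case: (uTQ i).
- by move=> i; split=> //=; apply: prefix0s.
- by move=> i; split=> //=; apply: suffix0s.
- by [].
- by move=> i j a aP aQ; apply/negP => /(shared_incident fam aP aQ); rewrite eqxx.
- by [].
- by [].
- by [].
- by left.
- right.
  have /choice[R1 R1P] i : exists q, {subset q <= P (g1 i)} /\ is_path x y q.
    by have [q sq pq] := walk_is_path (wP (g1 i)) ne; exists q.
  have /choice[R2 R2P] i : exists q, {subset q <= Q (g2 i)} /\ is_path y x q.
    have ne' : y != x by rewrite eq_sym.
    by have [q sq pq] := walk_is_path (wQ (g2 i)) ne'; exists q.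
  have sub1 i a : a \in R1 i -> a \in P (g1 i) by case: (R1P i) => + _; apply.
  have sub2 i a : a \in R2 i -> a \in Q (g2 i) by case: (R2P i) => + _; apply.
  exists (fun o => match o with inl i => R1 i | inr i => R2 i end); split.
  + by move=> i; case: (R1P i).
  + by move=> i; case: (R2P i).
  + move=> [i|i] [j|j] ij a ai; apply/negP => aj.
    * by apply: ij; congr inl; apply/inj1/(dP _ _ _ (sub1 _ _ ai) (sub1 _ _ aj)).
    * exact: dj12 (sub1 _ _ ai) (sub2 _ _ aj).
    * exact: dj12 (sub1 _ _ aj) (sub2 _ _ ai).
    * by apply: ij; congr inr; apply/inj2/(dQ _ _ _ (sub2 _ _ ai) (sub2 _ _ aj)).
Qed.
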